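(* Let $J_1=-\frac12$, $J_2=\frac12+\frac{\sqrt2}{2}$, $J_3=\frac{\sqrt2}{2}$, and let $H=J_1\,\mathbf{s}_2\cdot\mathbf{s}_3+J_2\,\mathbf{s}_3\cdot\mathbf{s}_1+J_3\,\mathbf{s}_1\cdot\mathbf{s}_2$ on $\mathcal{P}=\mathcal{S}^2\times\mathcal{S}^2\times\mathcal{S}^2$. Let $c(T)$ be the specific heat of the system with Hamiltonian $H$ and $c^\ast(T)$ the specific heat of the system with Hamiltonian $-H$. Then: (i) for $T\to\infty$, both $c(T)$ and $c^\ast(T)$ are equal to $\dfrac{3+\sqrt2}{6\,T^2}+O(T^{-3})$; (ii) for $T\to0^+$, $c(T)=2+\frac49\left(2-\sqrt2\right)T+\frac{40}{27}\left(3-2\sqrt2\right)T^2+O(T^3)$; (iii) $\lim_{T\to0^+}c^\ast(T)=\frac32$.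
   Context: $\mathcal{S}^2\subset\mathbb{R}^3$ is the unit sphere, $\mathbf{s}_1,\mathbf{s}_2,\mathbf{s}_3\in\mathcal{S}^2$ are the components of a point of $\mathcal{P}$, and $dV$ is the product of the surface measures on $\mathcal{P}$. For a Hamiltonian $K:\mathcal{P}\to\mathbb{R}$ and temperature $T>0$, with $\beta=1/T$, put $Z(\beta)=\int_{\mathcal{P}}e^{-\beta K}\,dV$ and $U_j(\beta)=\frac{1}{Z(\beta)}\int_{\mathcal{P}}K^j e^{-\beta K}\,dV$ for $j=1,2$. The specific heat is $\frac{\partial}{\partial T}U_1(1/T)=\beta^2\left(U_2(\beta)-U_1(\beta)^2\right)$ with $\beta=1/T$. *)

(* Defs.v *)
From HB Require Import structures.
From mathcomp Require Import all_boot all_order all_algebra.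
From mathcomp Require Import all_classical all_reals all_analysis.
From mathcomp Require Import measurable_realfun.

Set Implicit Arguments.
Unset Strict Implicit.
Unset Printing Implicit Defensive.

Import Order.TTheory GRing.Theory Num.Theory.
Import numFieldNormedType.Exports.

Local Open Scope classical_set_scope.
Local Open Scope ring_scope.

(* Vectors of R^3 are triples, so that they carry the library's product
   (i.e. Borel) sigma-algebra. *)
Notation vec3 R := (R * R * R)%type.

Definition dot (R : realType) (u v : vec3 R) : R :=
  u.1.1 * v.1.1 + u.1.2 * v.1.2 + u.2 * v.2.

Definition sphere (R : realType) : set (vec3 R) := [set v | dot v v = 1].
Arguments sphere R : clear implicits.

(* p = (theta, phi): colatitude theta in [0, pi], longitude phi in [0, 2pi] *)
Definition spherical_coord (R : realType) (p : R * R) : vec3 R :=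
  (sin p.1 * cos p.2, sin p.1 * sin p.2, cos p.1).

Definition spherical_dom (R : realType) : set (R * R) :=
  `[0, pi]%classic `*` `[0, 2 * pi]%classic.
Arguments spherical_dom R : clear implicits.

(* The surface measure of the unit sphere, seen as a measure on R^3.  The area
   element is |d_theta r x d_phi r| dtheta dphi = sin theta dtheta dphi, where
   r = spherical_coord; r is injective on the interior of spherical_dom, and
   misses only a null half-circle there. *)
Definition surface_measure (R : realType) (A : set (vec3 R)) : \bar R :=
  (\int[(@lebesgue_measure R) \x (@lebesgue_measure R)]_(p in
      spherical_dom R `&` @spherical_coord R @^-1` A) (sin p.1)%:E)%E.
Arguments surface_measure R A : clear implicits.

Section surface_measure_is_finite_measure.
Context (R : realType).
Local Notation mu2 := ((@lebesgue_measure R) \x (@lebesgue_measure R))%E.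

Lemma measurable_spherical_coord :
  measurable_fun [set: R * R] (@spherical_coord R).
Proof.
have ms : measurable_fun [set: R] (@sin R).
  by apply: continuous_measurable_fun; exact: continuous_sin.
have mc : measurable_fun [set: R] (@cos R).
  by apply: continuous_measurable_fun; exact: continuous_cos.
rewrite /spherical_coord; apply: measurable_fun_pair.
  apply: measurable_fun_pair; apply: measurable_funM;
    exact: measurableT_comp.
exact: measurableT_comp.
Qed.

Lemma measurable_spherical_dom : measurable (spherical_dom R).
Proof. by apply: measurableX; exact: measurable_itv. Qed.

Let mpre (A : set (vec3 R)) : measurable A ->
  measurable (spherical_dom R `&` @spherical_coord R @^-1` A).
Proof.
move=> mA; rewrite -(setTI (_ @^-1` _)).
apply: measurableI; first exact: measurable_spherical_dom.
exact: measurable_spherical_coord.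
Qed.

Let msin (D : set (R * R)) : measurable_fun D (fun p : R * R => (sin p.1)%:E).
Proof.
apply: measurable_funTS; apply/measurable_EFinP; apply: measurableT_comp => //.
by apply: continuous_measurable_fun; exact: continuous_sin.
Qed.

Let sin_dom_ge0 (p : R * R) : spherical_dom R p -> (0 <= (sin p.1)%:E :> \bar R)%E.
Proof.
by move=> -[/= h _]; move: h; rewrite lee_fin in_itv/=; exact: sin_ge0_pi.
Qed.

Let surface_measure0 : surface_measure R set0 = 0%E.
Proof. by rewrite /surface_measure preimage_set0 setI0 integral_set0. Qed.

Let surface_measure_ge0 A : (0 <= surface_measure R A)%E.
Proof. by apply: integral_ge0 => p [/sin_dom_ge0]. Qed.

Let surface_measure_sigma_additive : semi_sigma_additive (surface_measure R).
Proof.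
move=> /= F mF tF mUF; rewrite /surface_measure; apply: cvg_toP.
  apply: ereal_nondecreasing_is_cvgn => m n mn.
  by apply: lee_sum_nneg_natr => // k _ _; exact: surface_measure_ge0.
rewrite preimage_bigcup setI_bigcupr ge0_integral_bigcup//=.
- by move=> k; exact: mpre.
- exact: msin.
- by move=> p [k _ [/sin_dom_ge0]].
- apply/trivIsetP => i j _ _ ij.
  rewrite setIACA setIid -preimage_setI.
  by move/trivIsetP : tF => ->//; rewrite preimage_set0 setI0.
Qed.

HB.instance Definition _ := isMeasure.Build _ _ _ (surface_measure R)
  surface_measure0 surface_measure_ge0 surface_measure_sigma_additive.

Let surface_measure_fin : fin_num_fun (surface_measure R).
Proof.
move=> A mA; rewrite ge0_fin_numE//.
apply: (@le_lt_trans _ _ (\int[mu2]_(p in spherical_dom R) cst 1%:E p)%E).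
  rewrite /surface_measure.
  apply: (@le_trans _ _ (\int[mu2]_(p in spherical_dom R) (sin p.1)%:E)%E).
    apply: ge0_subset_integral => //.
    - exact: mpre.
    - exact: measurable_spherical_dom.
    - exact: msin.
  apply: ge0_le_integral => //.
  - exact: measurable_spherical_dom.
  - exact: msin.
  - by move=> p _; rewrite lee_fin sin_le1.
rewrite integral_cst/=; last exact: measurable_spherical_dom.
rewrite mul1e /spherical_dom product_measure1E//= !lebesgue_measure_itv/=.
by do 2 case: ifP => _; rewrite ?mule0 ?mul0e -?EFinB -?EFinM ?ltry.
Qed.

HB.instance Definition _ :=
  Measure_isFinite.Build _ _ _ (surface_measure R) surface_measure_fin.

End surface_measure_is_finite_measure.

Definition phase_space (R : realType) : set (vec3 R * vec3 R * vec3 R) :=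
  sphere R `*` sphere R `*` sphere R.
Arguments phase_space R : clear implicits.

Definition dV (R : realType) : set (vec3 R * vec3 R * vec3 R) -> \bar R :=
  (surface_measure R \x surface_measure R \x surface_measure R)%E.
Arguments dV R : clear implicits.

HB.instance Definition _ (R : realType) := Measure.on (dV R).

Section thermodynamics.
Context (R : realType).
Variable K : vec3 R * vec3 R * vec3 R -> R.

Definition Z (beta : R) : R :=
  \int[dV R]_(s in phase_space R) expR (- beta * K s).

Definition U (j : nat) (beta : R) : R :=
  (Z beta)^-1 *
  \int[dV R]_(s in phase_space R) (K s ^+ j * expR (- beta * K s)).

Definition specific_heat (T : R) : R := derive1 (fun t : R => U 1 t^-1) T.

End thermodynamics.

(* s = (s_1, s_2, s_3) *)
Definition hamiltonian (R : realType) (J1 J2 J3 : R)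
    (s : vec3 R * vec3 R * vec3 R) : R :=
  J1 * dot s.1.2 s.2 + J2 * dot s.2 s.1.1 + J3 * dot s.1.1 s.1.2.

(* The Landau notations need the packed filters T -> +oo and T -> 0^+. *)
Canonical pinfty_filter_on (R : realType) :=
  FilterType (pinfty_nbhs R) _.
Canonical at_right_filter_on (R : realType) (x : R) :=
  FilterType (at_right x) _.

(* Main.v *)
(* The area form in spherical coordinates and the divergence theorem on the sphere give the moments of s.v
   under the surface measure (Archimedes' hat-box theorem).  Integrating out s3, then s2, the moments of H
   become those of two quadratic polynomials P and Q of w = |J1 s2 + J2 s1|, so that, for every real x,
     x * int exp(x H) dV = const * int (exp(x P(w)) - exp(x Q(w))) dw.
   One integration by parts turns the right-hand side g(x) into the solution of a first-order linear
   differential equation with explicit exponential inhomogeneity B(x), and x^2 (log int exp(x H) dV)'', which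
   is c(-1/x) for x < 0 and cstar(1/x) for x > 0, becomes a polynomial in B/g, B'/g and 1/x.
   As x -> +oo the maximum of P is interior, B/g is exponentially small and 3/2 remains.  As x -> -oo the
   minimum of Q is at an endpoint, and an expansion of g to five terms gives (ii); the leading order of
   (i) is the variance of H at x = 0. *)

Require Import Defs.
From HB Require Import structures.
From mathcomp Require Import all_boot all_order all_algebra.
From mathcomp Require Import all_classical all_reals all_analysis.
From mathcomp Require Import measurable_realfun ring lra.
Import Order.TTheory GRing.Theory Num.Theory.
Import numFieldNormedType.Exports.
Local Open Scope classical_set_scope.
Local Open Scope ring_scope.

Set Implicit Arguments.
Unset Strict Implicit.
Unset Printing Implicit Defensive.

(** * Integration over the unit sphere *)

Section surface_integral.
Context (R : realType).
Local Notation mu2 := ((@lebesgue_measure R) \x (@lebesgue_measure R))%E.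
Local Notation dom := (spherical_dom R).
Local Notation crd := (@spherical_coord R).
Local Notation sigma := (surface_measure R).
Import HBNNSimple.

(** Over the phase space only integrals of polynomials are ever evaluated. Identities between
    exponential integrals come from comparing power series in x, and the substitution from s1.s2 to
    w acts on an antiderivative. In the coordinates that define [surface_measure] the rotation
    invariance is hidden, so moments in an arbitrary direction are obtained from a recursion. The
    two parabolas are exchanged by w -> -w and hence have the same peak value. This is why a single
    first-order equation governs the difference of their integrals. Part (ii) is shaped by a
    cancellation: x^2 multiplies a bracket whose terms are bounded but whose sum is only O(x^-2). An
    error O(T^3) therefore requires the one-dimensional integral with relative error O(x^-5), hence
    the five terms. *)

Lemma measurable_sin_colatitude (D : set (R * R)) :
  measurable_fun D (fun p : R * R => sin p.1).
Proof.
apply: measurable_funTS; apply: measurableT_comp => //.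
by apply: continuous_measurable_fun; exact: continuous_sin.
Qed.

Lemma sin_colatitude_ge0 (p : R * R) : dom p -> 0 <= sin p.1.
Proof. by move=> -[/= h _]; move: h; rewrite in_itv/=; exact: sin_ge0_pi. Qed.

Lemma measurable_indic_spherical_coord (A : set (vec3 R)) : measurable A ->
  measurable_fun setT (fun p => \1_A (crd p) : R).
Proof.
move=> mA; have m1 : measurable_fun setT (\1_A : vec3 R -> R).
  exact: measurable_indic.
exact: (measurableT_comp m1 (@measurable_spherical_coord R)).
Qed.

Local Open Scope ereal_scope.

(** The surface measure is the image of sin(theta) dtheta dphi under [spherical_coord]. By linearity
    it is enough to compare the measures of the level sets of h. *)
Lemma surface_integral_nnsfun (h : {nnsfun vec3 R >-> R}) :
  \int[sigma]_s (h s)%:E = \int[mu2]_(p in dom) ((h (crd p))%:E * (sin p.1)%:E).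
Proof.
have mdom := @measurable_spherical_dom R.
rewrite integralT_nnsfun sintegralE.
under [RHS]eq_integral => p pdom.
  rewrite fimfunE -fsumEFin// ge0_mule_fsuml; last first.
    by move=> r; rewrite nnfun_muleindic_ge0.
  over.
rewrite ge0_integral_fsum//; last 2 first.
- move=> r; apply: emeasurable_funM; last first.
    by apply/measurable_EFinP; exact: measurable_sin_colatitude.
  apply/measurable_EFinP/measurable_funM => //.
  apply: measurable_funTS; apply: measurable_indic_spherical_coord.
  exact: measurable_funPTI.
- move=> r p /sin_colatitude_ge0 p0.
  apply: mule_ge0; last by rewrite lee_fin.
  by rewrite EFinM; exact: nnfun_muleindic_ge0.
apply: eq_fsbigr => r /set_mem [s _ <-].
set A := h @^-1` _.
have mA : measurable A by exact: measurable_funPTI.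
under [RHS]eq_integral do rewrite EFinM -muleA.
rewrite ge0_integralZl//; last 3 first.
- apply: emeasurable_funM; last first.
    by apply/measurable_EFinP; exact: measurable_sin_colatitude.
  apply/measurable_EFinP; apply: measurable_funTS.
  exact: measurable_indic_spherical_coord.
- by move=> p /sin_colatitude_ge0 p0; rewrite mule_ge0 ?lee_fin.
- by rewrite lee_fin.
congr (_ * _).
(* This is the definition of [surface_measure] at A. *)
transitivity (\int[mu2]_(p in dom `&` crd @^-1` A) (sin p.1)%:E) => //.
rewrite [LHS]integral_mkcondr.
apply: eq_integral => p _; rewrite patchE indicE.
rewrite (_ : (p \in crd @^-1` A) = (crd p \in A)); last first.
  by apply/idP/idP; rewrite !inE.
by case: ifPn => _; rewrite ?mul1e ?mul0e.
Qed.

Lemma ge0_surface_integral (f : vec3 R -> \bar R) :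
  measurable_fun setT f -> (forall s, 0 <= f s) ->
  \int[sigma]_s f s = \int[mu2]_(p in dom) (f (crd p) * (sin p.1)%:E).
Proof.
move=> mf f0; have mdom := @measurable_spherical_dom R.
pose h := nnsfun_approx measurableT mf.
have fE s : f s = limn (fun n => (h n s)%:E).
  by apply/esym/cvg_lim => //; apply: cvg_nnsfun_approx.
under eq_integral do rewrite fE.
rewrite monotone_convergence//; last 3 first.
- by move=> n; exact/measurable_EFinP.
- by move=> n x _; rewrite lee_fin.
- by move=> x _ m n mn; rewrite lee_fin; exact/lefP/nd_nnsfun_approx.
under eq_fun do rewrite surface_integral_nnsfun.
rewrite -monotone_convergence//; last 3 first.
- move=> n; apply: emeasurable_funM; apply/measurable_EFinP.
    apply: measurable_funTS; apply: measurableT_comp => //.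
    exact: measurable_spherical_coord.
  exact: measurable_sin_colatitude.
- by move=> n p /sin_colatitude_ge0 p0; rewrite mule_ge0 ?lee_fin.
- move=> p /sin_colatitude_ge0 p0 m n mn; rewrite lee_wpmul2r ?lee_fin//.
  exact/lefP/nd_nnsfun_approx.
apply: eq_integral => p _; apply/cvg_lim => //.
by apply: cvgeZr => //; exact: cvg_nnsfun_approx.
Qed.

Local Close Scope ereal_scope.

Lemma measurable_dot d (T : measurableType d) (f g : T -> vec3 R) :
  measurable_fun setT f -> measurable_fun setT g ->
  measurable_fun setT (fun x => dot (f x) (g x)).
Proof.
move=> mf mg; rewrite /dot.
by do 2?apply: measurable_funD; apply: measurable_funM;
  do ?apply: measurableT_comp => //.
Qed.

Lemma measurable_sphere : measurable (sphere R).
Proof.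
rewrite (_ : sphere R = (fun v => dot v v) @^-1` [set 1]); last by [].
rewrite -(setTI (_ @^-1` _)); apply: measurable_dot => //; exact: measurable_id.
Qed.

Lemma spherical_coord_sphere (p : R * R) : sphere R (crd p).
Proof.
rewrite /sphere/= /dot/= -!expr2 !exprMn -mulrDr cos2Dsin2 mulr1.
by rewrite addrC cos2Dsin2.
Qed.

(** The restriction to the sphere disappears because [spherical_coord] only takes values there.
    Since sin is nonnegative on the coordinate domain, multiplication by it commutes with taking
    positive and negative parts. *)
Lemma surface_integral (f : vec3 R -> R) : measurable_fun setT f ->
  \int[sigma]_(s in sphere R) f s = \int[mu2]_(p in dom) (f (crd p) * sin p.1).
Proof.
move=> mf; rewrite /Rintegral; congr fine.
have mg : measurable_fun setT ((EFin \o f) \_ (sphere R)).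
  apply/(measurable_restrictT _ measurable_sphere).
  by apply: measurable_funTS; exact/measurable_EFinP.
have fE p : ((EFin \o f) \_ (sphere R)) (crd p) = (f (crd p))%:E.
  by rewrite patchE mem_set//; exact: spherical_coord_sphere.
rewrite integral_mkcond integralE.
rewrite ge0_surface_integral//; last exact: measurable_funepos.
rewrite ge0_surface_integral//; last exact: measurable_funeneg.
have maxM (x y : R) : 0 <= y ->
    (maxe x%:E 0 * y%:E = maxe (x * y)%:E 0 :> \bar R)%E.
  by move=> y0; rewrite -!EFin_max -EFinM maxr_pMl// mul0r.
rewrite [RHS]integralE; congr (_ - _)%E; apply: eq_integral => p /set_mem;
  move=> /sin_colatitude_ge0 p0.
- by rewrite !funeposE fE maxM.
- by rewrite !funenegE fE -!EFinN maxM// mulNr.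
Qed.

End surface_integral.

(** * Integration of bounded functions: fundamental theorem of calculus, finite sums, Fubini *)

Section bounded_integrals.
Context {R : realType}.

Lemma bounded_integrable d (T : measurableType d)
    (mu : {measure set T -> \bar R}) (D : set T) (f : T -> R) (M : R) :
  measurable D -> (mu D < +oo)%E -> measurable_fun D f ->
  (forall x, D x -> `|f x| <= M) -> mu.-integrable D (EFin \o f).
Proof.
move=> mD muD mf fM; apply: measurable_bounded_integrable => //.
exists M; split; first by rewrite num_real.
by move=> N MN x Dx; apply: le_trans (ltW MN); exact: fM.
Qed.

Lemma continuous_itv_integrable (f : R -> R) (a b : R) : continuous f ->
  (@lebesgue_measure R).-integrable `[a, b] (EFin \o f).
Proof.
move=> cf; apply: continuous_compact_integrable; first exact: segment_compact.
exact: continuous_subspaceT.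
Qed.

Lemma is_derive_continuous (f : R -> R) (x df : R) :
  is_derive (x : R) (1 : R) f df -> {for x, continuous f}.
Proof.
by move=> h; apply: differentiable_continuous; apply/derivable1_diffP.
Qed.

Lemma Rintegral_FTC2_itv (f F : R -> R) (a b : R) : a < b ->
  {in `[a, b], continuous f} ->
  (forall x, x \in `[a, b] -> is_derive (x : R) (1 : R) F (f x)) ->
  \int[lebesgue_measure]_(x in `[a, b]) f x = F b - F a.
Proof.
move=> ab cf dF.
have cF x : x \in `[a, b] -> {for x, continuous F}.
  by move=> /dF; exact: is_derive_continuous.
have subab x : x \in `]a, b[ -> x \in `[a, b].
  by rewrite !in_itv/= => /andP[/ltW -> /ltW ->].
rewrite /Rintegral (@continuous_FTC2 _ f F)//.
- by apply: continuous_in_subspaceT => x; rewrite inE; exact: cf.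
- split; first by move=> x /subab /dF [].
  + by apply: cvg_at_right_filter; apply: cF; rewrite in_itv/= lexx ltW.
  + by apply: cvg_at_left_filter; apply: cF; rewrite in_itv/= lexx ltW.
- by move=> x /subab /dF ?; rewrite derive1E derive_val.
Qed.

Lemma Rintegral_FTC2 (f F : R -> R) (a b : R) : a < b -> continuous f ->
  (forall x, is_derive (x : R) (1 : R) F (f x)) ->
  \int[lebesgue_measure]_(x in `[a, b]) f x = F b - F a.
Proof. by move=> ab cf dF; apply: Rintegral_FTC2_itv => // x _; exact: cf. Qed.

Lemma Rintegral_bigsum d (T : measurableType d)
    (mu : {measure set T -> \bar R}) (D : set T) (I : Type) (s : seq I)
    (f : I -> T -> R) : measurable D ->
  (forall i, mu.-integrable D (EFin \o f i)) ->
  \int[mu]_(x in D) (\sum_(i <- s) f i x) =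
  \sum_(i <- s) \int[mu]_(x in D) f i x.
Proof.
move=> mD fi; suff [] : mu.-integrable D (EFin \o (fun x => \sum_(i <- s) f i x)) /\
  \int[mu]_(x in D) (\sum_(i <- s) f i x) =
  \sum_(i <- s) \int[mu]_(x in D) f i x by [].
elim: s => [|i s [ih1 ih2]].
  rewrite big_nil; under [X in _ /\ (X = _)]eq_Rintegral do rewrite big_nil.
  rewrite Rintegral_cst// mul0r; split => //.
  rewrite (_ : _ \o _ = cst 0%E); first exact: integrable0.
  by apply/funext => x /=; rewrite big_nil.
rewrite big_cons; under [X in _ /\ (X = _)]eq_Rintegral do rewrite big_cons.
rewrite RintegralD// ih2; split => //.
rewrite (_ : _ \o _ =
  ((EFin \o f i) \+ (EFin \o (fun x => (\sum_(i <- s) f i x)%R)))%E).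
  exact: integrableD.
by apply/funext => x /=; rewrite big_cons.
Qed.

(** A sufficient condition for integrability over a set of finite measure that is stable under
    products. Measurability is asked on the whole space so that composition needs no domain
    bookkeeping; the bound is asked on D only. *)
Definition bounded_measurable d (T : measurableType d) (D : set T) (f : T -> R) :=
  measurable_fun setT f /\ exists M, forall x, D x -> `|f x| <= M.

Section bounded_measurable.
Context d (T : measurableType d) (D : set T).
Implicit Types f g : T -> R.

Lemma bounded_measurable_cst (c : R) : bounded_measurable D (fun=> c).
Proof. by split; [exact: measurable_cst|exists `|c|]. Qed.

Lemma bounded_measurableD f g : bounded_measurable D f ->
  bounded_measurable D g -> bounded_measurable D (fun x => f x + g x).
Proof.
move=> [mf [M fM]] [mg [N gN]]; split; first exact: measurable_funD.
exists (M + N) => x Dx; apply: le_trans (ler_normD _ _) _.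
by rewrite lerD ?fM ?gN.
Qed.

Lemma bounded_measurableM f g : bounded_measurable D f ->
  bounded_measurable D g -> bounded_measurable D (fun x => f x * g x).
Proof.
move=> [mf [M fM]] [mg [N gN]]; split; first exact: measurable_funM.
by exists (M * N) => x Dx; rewrite normrM ler_pM ?fM ?gN.
Qed.

Lemma bounded_measurableN f : bounded_measurable D f ->
  bounded_measurable D (fun x => - f x).
Proof.
move=> bf; rewrite (_ : (fun _ => _) = fun x => (-1) * f x).
  by apply: bounded_measurableM => //; exact: bounded_measurable_cst.
by apply/funext => x; rewrite mulN1r.
Qed.

Lemma bounded_measurableX f n : bounded_measurable D f ->
  bounded_measurable D (fun x => f x ^+ n).
Proof.
move=> [mf [M fM]]; split; first exact: measurable_funX.
by exists (M ^+ n) => x Dx; rewrite normrX lerXn2r ?nnegrE ?fM// (le_trans _ (fM x _)).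
Qed.

Lemma bounded_measurable_horner (p : {poly R}) f : bounded_measurable D f ->
  bounded_measurable D (fun x => p.[f x]).
Proof.
move=> bf; elim/poly_ind: p => [|p c ih].
  rewrite (_ : (fun _ => _) = fun=> 0); first exact: bounded_measurable_cst.
  by apply/funext => x; rewrite horner0.
rewrite (_ : (fun _ => _) = fun x => p.[f x] * f x + c).
  apply: bounded_measurableD; last exact: bounded_measurable_cst.
  exact: bounded_measurableM.
by apply/funext => x; rewrite hornerMXaddC.
Qed.

Lemma bounded_measurable_integrable (mu : {measure set T -> \bar R}) f :
  measurable D -> (mu D < +oo)%E -> bounded_measurable D f ->
  mu.-integrable D (EFin \o f).
Proof.
move=> mD muD [mf [M fM]]; apply: (bounded_integrable mD muD _ fM).
exact: measurable_funTS.
Qed.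

End bounded_measurable.

Lemma is_derive_fM (f g : R -> R) (x df dg : R) :
  is_derive (x : R) (1 : R) f df -> is_derive (x : R) (1 : R) g dg ->
  is_derive (x : R) (1 : R) (fun y => f y * g y) (df * g x + f x * dg).
Proof.
move=> hf hg; apply: (is_derive_eq (is_deriveM hf hg)).
by rewrite /GRing.scale/= addrC [g x * _]mulrC.
Qed.

Lemma is_derive_fX (f : R -> R) n (x df : R) :
  is_derive (x : R) (1 : R) f df ->
  is_derive (x : R) (1 : R) (fun y => f y ^+ n) (n%:R * f x ^+ n.-1 * df).
Proof.
move=> hf; rewrite (_ : (fun y => f y ^+ n) = f ^+ n).
  exact: (is_derive_eq (is_deriveX n hf)).
by apply/funext => y; rewrite fctE.
Qed.

Section fubini.
Context d1 d2 (T1 : measurableType d1) (T2 : measurableType d2).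
Variable m1 : {sigma_finite_measure set T1 -> \bar R}.
Variable m2 : {sigma_finite_measure set T2 -> \bar R}.
Variables (A : set T1) (B : set T2) (f : T1 * T2 -> R).
Hypotheses (mA : measurable A) (mB : measurable B).
Hypotheses (fA : (m1 A < +oo)%E) (fB : (m2 B < +oo)%E).
Hypothesis bf : bounded_measurable (A `*` B) f.

Let mf : measurable_fun setT f. Proof. by case: bf. Qed.

(** Extension by zero reduces the theorem on a rectangle to the one on the full product. *)
Let g : T1 * T2 -> \bar R := (EFin \o f) \_ (A `*` B).

Let mAB : measurable (A `*` B). Proof. exact: measurableX. Qed.

Lemma bounded_integrable_prod : (m1 \x m2)%E.-integrable (A `*` B) (EFin \o f).
Proof.
apply: bounded_measurable_integrable => //.
rewrite [ltLHS]product_measure1E// lte_mul_pinfty//.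
by rewrite ge0_fin_numE.
Qed.

Let ig : (m1 \x m2)%E.-integrable setT g.
Proof.
by apply/(integrable_mkcond _ mAB); exact: bounded_integrable_prod.
Qed.

Let gE x y : g (x, y) = if (x \in A) && (y \in B) then (f (x, y))%:E else 0%E.
Proof.
rewrite /g patchE; congr (if _ then _ else _).
apply/idP/idP; first by rewrite inE => -[/= /mem_set -> /mem_set ->].
by move=> /andP[/set_mem Ax /set_mem By]; rewrite inE; split.
Qed.

Lemma Rintegral_prod12 : \int[(m1 \x m2)%E]_(z in A `*` B) f z =
  \int[m1]_(x in A) \int[m2]_(y in B) f (x, y).
Proof.
rewrite /Rintegral integral_mkcond -(integral12_prod_meas1 ig); congr fine.
rewrite [RHS]integral_mkcond; apply: eq_integral => x _; rewrite patchE.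
rewrite /fubini_F; case: ifPn => xA.
  rewrite fineK; last first.
    have [_ [M fM]] := bf.
    apply: integrable_fin_num => //; apply: (@bounded_integrable _ _ _ _ _ M) => //.
    - by apply: measurable_funTS; apply: measurableT_comp.
    - by move=> y By; apply: fM; split => //; exact/set_mem.
  rewrite [RHS]integral_mkcond; apply: eq_integral => y _.
  by rewrite gE xA patchE.
by rewrite integral0_eq// => y _; rewrite gE (negbTE xA).
Qed.

Lemma Rintegral_prod21 : \int[(m1 \x m2)%E]_(z in A `*` B) f z =
  \int[m2]_(y in B) \int[m1]_(x in A) f (x, y).
Proof.
rewrite /Rintegral integral_mkcond -(integral21_prod_meas1 ig); congr fine.
rewrite [RHS]integral_mkcond; apply: eq_integral => y _; rewrite patchE.
rewrite /fubini_G; case: ifPn => yB.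
  rewrite fineK; last first.
    have [_ [M fM]] := bf.
    apply: integrable_fin_num => //; apply: (@bounded_integrable _ _ _ _ _ M) => //.
    - by apply: measurable_funTS; apply: measurableT_comp.
    - by move=> x Ax; apply: fM; split => //; exact/set_mem.
  rewrite [RHS]integral_mkcond; apply: eq_integral => x _.
  by rewrite gE yB andbT patchE.
by rewrite integral0_eq// => x _; rewrite gE (negbTE yB) andbF.
Qed.

End fubini.

End bounded_integrals.

(** * Exponential families *)

Section exponential_family.
Context {R : realType} d {T : measurableType d}.
Variables (mu : {measure set T -> \bar R}) (D : set T) (K : T -> R) (M : R).
Hypotheses (mD : measurable D) (fD : (mu D < +oo)%E).
Hypothesis mK : measurable_fun D K.
Hypothesis KM : forall s, D s -> `|K s| <= M.

Definition exp_moment (j : nat) (x : R) : R :=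
  \int[mu]_(s in D) (K s ^+ j * expR (x * K s)).

Lemma measurable_exp_moment_integrand j x :
  measurable_fun D (fun s => K s ^+ j * expR (x * K s)).
Proof.
apply: measurable_funM; first exact: measurable_funX.
by apply: measurableT_comp => //; apply: measurable_funM.
Qed.

Lemma exp_moment_integrand_le j x s : D s ->
  `|K s ^+ j * expR (x * K s)| <= M ^+ j * expR (`|x| * M).
Proof.
move=> Ds; rewrite normrM normrX (ger0_norm (expR_ge0 _)).
apply: ler_pM; rewrite ?exprn_ge0 ?expR_ge0//.
  by rewrite lerXn2r ?nnegrE//; [exact: le_trans (KM Ds)|exact: KM].
rewrite ler_expR (le_trans (ler_norm _))// normrM ler_wpM2l//.
exact: KM.
Qed.

Lemma integrable_exp_moment j x :
  mu.-integrable D (EFin \o (fun s => K s ^+ j * expR (x * K s))).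
Proof.
apply: (bounded_integrable mD fD).
- exact: measurable_exp_moment_integrand.
- by move=> s; exact: exp_moment_integrand_le.
Qed.

(** Differentiation under the integral sign on ]x - 1, x + 1[, where the derivative of the integrand
    is dominated by a constant. *)
Lemma is_derive_exp_moment j x : is_derive (x : R) (1 : R) (exp_moment j) (exp_moment j.+1 x).
Proof.
pose f (y : R) s := K s ^+ j * expR (y * K s).
have df y s : is_derive (y : R) (1 : R) (f ^~ s) (K s ^+ j.+1 * expR (y * K s)).
  rewrite /f; apply: is_derive_eq; rewrite /GRing.scale/=.
  by rewrite mulr0 mulr1 add0r exprSr -mulrA [expR _ * _]mulrC.
have xI : `]x - 1, x + 1[%classic x by rewrite /= in_itv/= ltrBlDr ltrDl ltr01.
(* If D is empty then M may be negative, while the dominating function has to be nonnegative; hence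
   the absolute values. *)
pose G : T -> R := cst (`|M| ^+ j.+1 * expR ((`|x| + 1) * `|M|)).
have G0 y : 0 <= G y by rewrite /G mulr_ge0 ?exprn_ge0 ?expR_ge0.
have iG : mu.-integrable D (EFin \o G).
  by apply: (@bounded_integrable _ _ _ mu D G (`|G point|)) => //; exact: measurable_cst.
have Gub y s : `]x - 1, x + 1[%classic y -> D s ->
    `|partial1of2 f y s| <= G s.
  rewrite /= in_itv/= => yx Ds.
  rewrite partial1of2E derive_val; apply: le_trans (exp_moment_integrand_le _ _ Ds) _.
  have M0 : 0 <= M by exact: le_trans (KM Ds).
  rewrite /G /= (ger0_norm M0) ler_wpM2l ?exprn_ge0// ler_expR ler_wpM2r//.
  have : `|y - x| <= 1.
    by rewrite ler_norml; move: yx => /andP[? ?]; apply/andP; split; lra.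
  have := ler_normD (y - x) x; rewrite subrK; lra.
have If y : `]x - 1, x + 1[%classic y -> mu.-integrable D (EFin \o f y).
  by move=> _; exact: integrable_exp_moment.
have dF y s : `]x - 1, x + 1[%classic y -> D s -> derivable (f ^~ s) y 1.
  by move=> _ _; have := df y s.
have dd := derivable_under_integral mD xI If dF G0 iG Gub.
have de := differentiation_under_integral mD xI If dF G0 iG Gub.
apply: DeriveDef => //.
rewrite -derive1E [LHS]de; apply: eq_Rintegral => s _.
by rewrite partial1of2E derive_val.
Qed.

(** Dominated convergence: the partial sums of exp(x K) are bounded by exp(|x| M). The moments at 0
    thus determine the whole function, which lets polynomial identities pass to exponentials. *)
Lemma exp_moment_series x :
  series (fun n => x ^+ n / n`!%:R * exp_moment n 0) n @[n --> \oo] -->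
    exp_moment 0 x.
Proof.
pose f_ n s := series (exp_coeff (x * K s)) n.
have f_E n s : f_ n s = \sum_(0 <= i < n) x ^+ i / i`!%:R * (K s ^+ i * expR (0 * K s)).
  rewrite /f_ /series/=; apply: eq_bigr => i _.
  by rewrite exp_coeffE mul0r expR0 mulr1 exprMn; ring.
have mf_ n : measurable_fun D (f_ n).
  rewrite (_ : f_ n = fun s => \sum_(0 <= i < n) x ^+ i / i`!%:R * (K s ^+ i * expR (0 * K s))).
    apply: measurable_sum => i; apply: measurable_funM => //.
    exact: measurable_exp_moment_integrand.
  by apply/funext => s; rewrite f_E.
have f_le n s : D s -> `|f_ n s| <= expR (`|x| * M).
  move=> Ds; apply: (@le_trans _ _ (series (exp_coeff (`|x| * M)) n)).
    rewrite /f_ /series/=; apply: le_trans (ler_norm_sum _ _ _) _.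
    apply: ler_sum => i _; rewrite /exp_coeff/= normrM normrX normrM.
    rewrite [`|_^-1|]ger0_norm ?invr_ge0 ?ler0n// ler_wpM2r ?invr_ge0 ?ler0n//.
    rewrite lerXn2r ?nnegrE ?mulr_ge0//; first exact: le_trans (KM Ds).
    by rewrite ler_wpM2l// KM.
  have M0 : 0 <= M by exact: le_trans (KM Ds).
  rewrite /expR; apply: nondecreasing_cvgn_le; last exact: is_cvg_series_exp_coeff.
  apply/nondecreasing_seqP => k; rewrite /series/= big_nat_recr//= lerDl.
  by rewrite exp_coeff_ge0// mulr_ge0.
have f_cvg s : f_ n s @[n --> \oo] --> expR (x * K s).
  exact: is_cvg_series_exp_coeff.
have ig : mu.-integrable D (EFin \o cst (expR (`|x| * M))).
  apply: (@bounded_integrable _ _ _ mu D _ (expR (`|x| * M))) => //.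
  by move=> s _; rewrite ger0_norm// expR_ge0.
have [|||||_ _] := @dominated_convergence _ _ _ mu D mD
  (fun n s => (f_ n s)%:E) (fun s => (expR (x * K s))%:E)
  (EFin \o cst (expR (`|x| * M))).
- by move=> n; exact/measurable_EFinP.
- apply/measurable_EFinP; apply: measurableT_comp => //.
  exact: measurable_funM.
- apply: aeW => s Ds; apply: cvg_EFin; first exact: nearW.
  exact: f_cvg.
- exact: ig.
- by apply: aeW => s n Ds; rewrite lee_fin f_le.
have iE : mu.-integrable D (EFin \o (fun s => expR (x * K s))).
  apply: eq_integrable (integrable_exp_moment 0 x) => // s _ /=.
  by rewrite expr0 mul1r.
rewrite -[X in _ --> X -> _]fineK; last exact: integrable_fin_num.
move=> h; have {h} := fine_cvg h.
rewrite (_ : exp_moment 0 x = \int[mu]_(s in D) expR (x * K s)); last first.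
  by apply: eq_Rintegral => s _; rewrite expr0 mul1r.
move=> h.
have sE : series (fun n => x ^+ n / n`!%:R * exp_moment n 0) =
    fine \o (fun n => \int[mu]_(s in D) (f_ n s)%:E)%E.
  apply/funext => n; rewrite /series/=.
  transitivity (\int[mu]_(s in D) f_ n s) => //.
  under [RHS]eq_Rintegral do rewrite f_E.
  rewrite Rintegral_bigsum//; last first.
    move=> i; have := integrableZl mD (x ^+ i / i`!%:R) (integrable_exp_moment i 0).
    by apply: eq_integrable => // s _ /=; rewrite EFinM.
  by apply: eq_bigr => i _; rewrite RintegralZl//; exact: integrable_exp_moment.
by rewrite sE; exact: h.
Qed.

End exponential_family.

(** * The hat-box theorem *)

Section sphere_moments.
Context {R : realType}.
Local Notation mu := (@lebesgue_measure R).
Local Notation mu2 := ((@lebesgue_measure R) \x (@lebesgue_measure R))%E.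
Local Notation dom := (spherical_dom R).
Local Notation crd := (@spherical_coord R).
Local Notation sigma := (surface_measure R).

Lemma lebesgue_measure_segment_lty (a b : R) : (mu `[a, b] < +oo)%E.
Proof. by rewrite lebesgue_measure_itv/=; case: ifP => // _; rewrite -EFinB ltry. Qed.

Lemma bounded_measurable_sin : bounded_measurable [set: R] (@sin R).
Proof.
split; first by apply: continuous_measurable_fun; exact: continuous_sin.
by exists 1 => x _; rewrite ler_norml sin_geN1 sin_le1.
Qed.

Lemma bounded_measurable_cos : bounded_measurable [set: R] (@cos R).
Proof.
split; first by apply: continuous_measurable_fun; exact: continuous_cos.
by exists 1 => x _; rewrite ler_norml cos_geN1 cos_le1.
Qed.

Lemma bounded_measurable_comp d1 d2 (T1 : measurableType d1)
    (T2 : measurableType d2) (D : set T1) (f : T2 -> R) (g : T1 -> T2) :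
  bounded_measurable setT f -> measurable_fun setT g ->
  bounded_measurable D (f \o g).
Proof.
move=> [mf [M fM]] mg; split; first exact: measurableT_comp.
by exists M => x _; exact: fM.
Qed.

Lemma dotC (s t : vec3 R) : dot s t = dot t s.
Proof. by rewrite /dot; ring. Qed.

Lemma dot_norm_le1 (s t : vec3 R) : sphere R s -> sphere R t -> `|dot s t| <= 1.
Proof.
rewrite /sphere/= /dot => hs ht; rewrite ler_norml; apply/andP; split.
  have := sqr_ge0 (s.1.1 + t.1.1); have := sqr_ge0 (s.1.2 + t.1.2).
  by have := sqr_ge0 (s.2 + t.2); rewrite !sqrrD !expr2; lra.
have := sqr_ge0 (s.1.1 - t.1.1); have := sqr_ge0 (s.1.2 - t.1.2).
by have := sqr_ge0 (s.2 - t.2); rewrite !sqrrB !expr2; lra.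
Qed.

Lemma bounded_measurable_dot (v : vec3 R) :
  bounded_measurable (sphere R) (fun s => dot s v).
Proof.
split; first by apply: measurable_dot => //; exact: measurable_cst.
exists (1 + dot v v) => s; rewrite /sphere/= /dot => hs.
rewrite ler_norml; apply/andP; split.
  have := sqr_ge0 (s.1.1 + v.1.1); have := sqr_ge0 (s.1.2 + v.1.2).
  have := sqr_ge0 (s.2 + v.2); rewrite !sqrrD !expr2.
  have := sqr_ge0 v.1.1; have := sqr_ge0 v.1.2; have := sqr_ge0 v.2; rewrite !expr2; lra.
have := sqr_ge0 (s.1.1 - v.1.1); have := sqr_ge0 (s.1.2 - v.1.2).
have := sqr_ge0 (s.2 - v.2); rewrite !sqrrB !expr2.
have := sqr_ge0 v.1.1; have := sqr_ge0 v.1.2; have := sqr_ge0 v.2; rewrite !expr2; lra.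
Qed.

Lemma surface_measure_lty (D : set (vec3 R)) : measurable D -> (sigma D < +oo)%E.
Proof. by move=> mD; rewrite -ge0_fin_numE//; exact: fin_num_measure. Qed.

Lemma integral_spherical_dom12 (f : R * R -> R) : bounded_measurable dom f ->
  \int[mu2]_(z in dom) f z =
  \int[mu]_(t in `[0, pi]) \int[mu]_(p in `[0, 2 * pi]) f (t, p).
Proof.
by move=> bf; apply: Rintegral_prod12 => //; exact: lebesgue_measure_segment_lty.
Qed.

Lemma integral_spherical_dom21 (f : R * R -> R) : bounded_measurable dom f ->
  \int[mu2]_(z in dom) f z =
  \int[mu]_(p in `[0, 2 * pi]) \int[mu]_(t in `[0, pi]) f (t, p).
Proof.
by move=> bf; apply: Rintegral_prod21 => //; exact: lebesgue_measure_segment_lty.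
Qed.

Section fixed_vector.
Variable v : vec3 R.
(** The height in the direction v. In the orthonormal frame of colatitude and longitude, [(ut, psi)]
    is its gradient on the sphere; the longitude derivative carries the extra factor sin t. *)
Let u (t p : R) := dot (crd (t, p)) v.
Let ut (t p : R) := cos t * (v.1.1 * cos p + v.1.2 * sin p) - sin t * v.2.
Let psi (p : R) := v.1.2 * cos p - v.1.1 * sin p.

Let derive_u_colatitude t p : is_derive (t : R) (1 : R) (u ^~ p) (ut t p).
Proof.
rewrite /u /ut /dot /spherical_coord/=; apply: is_derive_eq.
by rewrite /GRing.scale/=; ring.
Qed.

Let derive_u_longitude t p : is_derive (p : R) (1 : R) (u t) (sin t * psi p).
Proof.
rewrite /u /psi /dot /spherical_coord/=; apply: is_derive_eq.
by rewrite /GRing.scale/=; ring.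
Qed.

Let derive_ut t p : is_derive (t : R) (1 : R) (ut ^~ p) (- u t p).
Proof.
rewrite /u /ut /dot /spherical_coord/=; apply: is_derive_eq.
by rewrite /GRing.scale/=; ring.
Qed.

Let derive_psi p : is_derive (p : R) (1 : R) psi
  (- (v.1.1 * cos p + v.1.2 * sin p)).
Proof.
rewrite /psi; apply: is_derive_eq.
by rewrite /GRing.scale/=; ring.
Qed.

(** [f1] and [f2] are the two partial derivatives that make up a divergence in spherical
    coordinates. At m = 0 the exponent m.-1 is truncated to 0, but it occurs only with the
    coefficient m. *)
Let f1 m t p := cos t * u t p ^+ m * ut t p +
  sin t * (m%:R * u t p ^+ m.-1 * ut t p ^+ 2) - sin t * u t p ^+ m.+1.
Let f2 m t p := m%:R * u t p ^+ m.-1 * sin t * psi p ^+ 2 -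
  u t p ^+ m * (v.1.1 * cos p + v.1.2 * sin p).

Let derive_f1 m t p : is_derive (t : R) (1 : R)
  (fun t => sin t * u t p ^+ m * ut t p) (f1 m t p).
Proof.
apply: (is_derive_eq (is_derive_fM (is_derive_fM (is_derive_sin t)
  (is_derive_fX m (derive_u_colatitude t p))) (derive_ut t p))).
by rewrite /f1 [_ ^+ m.+1]exprS; move: (_ ^+ m) (_ ^+ m.-1) (m%:R) => a b c; ring.
Qed.

Let derive_f2 m t p : is_derive (p : R) (1 : R)
  (fun p => u t p ^+ m * psi p) (f2 m t p).
Proof.
apply: (is_derive_eq (is_derive_fM (is_derive_fX m (derive_u_longitude t p))
  (derive_psi p))).
by rewrite /f2; move: (_ ^+ m) (_ ^+ m.-1) (m%:R) => a b c; ring.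
Qed.

Let c p := v.1.1 * cos p + v.1.2 * sin p.

Let cos_ut t p : cos t * ut t p = c p - sin t * u t p.
Proof.
have h := cos2Dsin2 t.
apply/eqP; rewrite -subr_eq0 (_ : _ - _ = c p * (cos t ^+ 2 + sin t ^+ 2 - 1)).
  by rewrite h subrr mulr0.
by rewrite /u /ut /c /dot /spherical_coord/=; ring.
Qed.

(** Pythagoras: the gradient of u is the tangential part of v, and u is its normal component. *)
Let ut2_psi2 t p : ut t p ^+ 2 + psi p ^+ 2 = dot v v - u t p ^+ 2.
Proof.
apply/eqP; rewrite eq_sym subr_eq eq_sym; apply/eqP.
transitivity ((c p ^+ 2 + v.2 ^+ 2) * (cos t ^+ 2 + sin t ^+ 2) + psi p ^+ 2).
  by rewrite /u /ut /c /dot /spherical_coord/=; ring.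
rewrite cos2Dsin2 mulr1.
transitivity ((v.1.1 ^+ 2 + v.1.2 ^+ 2) * (cos p ^+ 2 + sin p ^+ 2) + v.2 ^+ 2).
  by rewrite /c /psi; ring.
by rewrite cos2Dsin2 /dot; ring.
Qed.

(* The left-hand side is sin t times the divergence of u^m grad u on the sphere. *)
Let divergence m t p : f1 m t p + f2 m t p =
  m%:R * dot v v * (u t p ^+ m.-1 * sin t) - m.+2%:R * (u t p ^+ m.+1 * sin t).
Proof.
rewrite /f1 /f2 -/(c p).
transitivity ((cos t * ut t p) * u t p ^+ m - c p * u t p ^+ m
  - sin t * u t p ^+ m.+1
  + m%:R * u t p ^+ m.-1 * sin t * (ut t p ^+ 2 + psi p ^+ 2)).
  by move: (_ ^+ m) (_ ^+ m.-1) (_ ^+ m.+1) (m%:R) => x y z n; ring.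
rewrite cos_ut ut2_psi2; case: m => [|m] /=.
  by rewrite expr1 expr0; ring.
rewrite !exprS -!natr1; move: (m%:R : R) (u t p ^+ m) => n um; ring.
Qed.

Let bmu m : bounded_measurable dom (fun z => u z.1 z.2 ^+ m).
Proof.
apply: bounded_measurableX; rewrite /u; split.
  apply: measurable_dot; last exact: measurable_cst.
  rewrite (_ : (fun _ => _) = crd); last by apply/funext => -[].
  exact: measurable_spherical_coord.
have [_ [M hM]] := bounded_measurable_dot v.
by exists M => z _; apply: hM; exact: spherical_coord_sphere.
Qed.

Let bms1 : bounded_measurable dom (fun z : R * R => sin z.1).
Proof. exact: (bounded_measurable_comp _ bounded_measurable_sin). Qed.
Let bms2 : bounded_measurable dom (fun z : R * R => sin z.2).
Proof. exact: (bounded_measurable_comp _ bounded_measurable_sin). Qed.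
Let bmc1 : bounded_measurable dom (fun z : R * R => cos z.1).
Proof. exact: (bounded_measurable_comp _ bounded_measurable_cos). Qed.
Let bmc2 : bounded_measurable dom (fun z : R * R => cos z.2).
Proof. exact: (bounded_measurable_comp _ bounded_measurable_cos). Qed.

Ltac bm := repeat first [exact: bounded_measurable_cst | exact: bmu
  | exact: bms1 | exact: bms2 | exact: bmc1 | exact: bmc2
  | apply: bounded_measurableD | apply: bounded_measurableN
  | apply: bounded_measurableM | apply: bounded_measurableX].

Let bf1 m : bounded_measurable dom (fun z => f1 m z.1 z.2).
Proof. rewrite /f1 /ut; bm. Qed.

Let bf2 m : bounded_measurable dom (fun z => f2 m z.1 z.2).
Proof. rewrite /f2 /psi; bm. Qed.

Let cont (f : R -> R) (df : R -> R) :
  (forall x, is_derive (x : R) (1 : R) f (df x)) -> continuous f.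
Proof.
by move=> h x; apply: differentiable_continuous; apply/derivable1_diffP.
Qed.

Let cvg_cos (x : R) : cos y @[y --> x] --> cos x.
Proof. exact: continuous_cos. Qed.
Let cvg_sin (x : R) : sin y @[y --> x] --> sin x.
Proof. exact: continuous_sin. Qed.
Let cvg_ut (x : R) p : ut y p @[y --> x] --> ut x p.
Proof. exact: (cont (derive_ut ^~ p)). Qed.
Let cvg_u1 m (x : R) p : u y p ^+ m @[y --> x] --> u x p ^+ m.
Proof.
exact: (cont (fun t => is_derive_fX m (derive_u_colatitude t p))).
Qed.
Let cvg_u2 m (x : R) t : u t y ^+ m @[y --> x] --> u t x ^+ m.
Proof.
exact: (cont (fun p => is_derive_fX m (derive_u_longitude t p))).
Qed.

Let cvg_ut2 (x : R) p : ut y p ^+ 2 @[y --> x] --> ut x p ^+ 2.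
Proof. exact: (cont (fun t => is_derive_fX 2 (derive_ut t p))). Qed.
Let cvg_psi2 (x : R) : psi y ^+ 2 @[y --> x] --> psi x ^+ 2.
Proof. exact: (cont (fun p => is_derive_fX 2 (derive_psi p))). Qed.

Let continuous_f1 m p : continuous (f1 m ^~ p).
Proof.
move=> t; rewrite /f1; apply: cvgB.
  apply: cvgD; apply: cvgM.
  - by apply: cvgM; [exact: cvg_cos|exact: cvg_u1].
  - exact: cvg_ut.
  - exact: cvg_sin.
  - apply: cvgM; last exact: cvg_ut2.
    by apply: cvgM; [exact: cvg_cst|exact: cvg_u1].
by apply: cvgM; [exact: cvg_sin|exact: cvg_u1].
Qed.

Let continuous_f2 m t : continuous (f2 m t).
Proof.
move=> p; rewrite /f2; apply: cvgB; apply: cvgM.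
- apply: cvgM; last exact: cvg_cst.
  by apply: cvgM; [exact: cvg_cst|exact: cvg_u2].
- exact: cvg_psi2.
- exact: cvg_u2.
- by apply: cvgD; apply: cvgM; [exact: cvg_cst|exact: cvg_cos|exact: cvg_cst|exact: cvg_sin].
Qed.

Let int_f1 m : \int[mu2]_(z in dom) f1 m z.1 z.2 = 0.
Proof.
rewrite (integral_spherical_dom21 (bf1 m))/=.
under eq_Rintegral => p _.
  rewrite (Rintegral_FTC2 (pi_gt0 R) (@continuous_f1 m p) (fun t => derive_f1 m t p)).
  (* The flux through the two poles vanishes with sin t. *)
  rewrite sinpi sin0 !mul0r subrr; over.
by rewrite Rintegral_cst// mul0r.
Qed.

Let int_f2 m : \int[mu2]_(z in dom) f2 m z.1 z.2 = 0.
Proof.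
rewrite (integral_spherical_dom12 (bf2 m))/=.
under eq_Rintegral => t _.
  have tau0 : (0 : R) < 2 * pi by rewrite mulr_gt0// pi_gt0.
  rewrite (Rintegral_FTC2 tau0 (@continuous_f2 m t) (fun p => derive_f2 m t p)).
  (* The flux is periodic in the longitude. *)
  rewrite /u /psi /dot /spherical_coord/= mulr_natl cos2pi sin2pi cos0 sin0 subrr; over.
by rewrite Rintegral_cst// mul0r.
Qed.

Local Notation M k := (\int[sigma]_(s in sphere R) dot s v ^+ k).

Let momentE k : M k = \int[mu2]_(z in dom) (u z.1 z.2 ^+ k * sin z.1).
Proof.
rewrite surface_integral; last first.
  by have [] := bounded_measurableX k (bounded_measurable_dot v).
by apply: eq_Rintegral => -[t p].
Qed.

Let idom f : bounded_measurable dom f -> mu2.-integrable dom (EFin \o f).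
Proof.
by move=> bf; apply: bounded_integrable_prod => //; exact: lebesgue_measure_segment_lty.
Qed.

(** Integrate [divergence]: the left-hand side integrates to zero. For m = 0 this says that the
    first moment vanishes. *)
Let moment_rec m : m.+2%:R * M m.+1 = m%:R * dot v v * M m.-1.
Proof.
have mdom := @measurable_spherical_dom R.
apply/eqP; rewrite eq_sym -subr_eq0; apply/eqP.
rewrite !momentE -!RintegralZl//; last 2 first.
- by apply: idom; bm.
- by apply: idom; bm.
rewrite -RintegralB//; last 2 first.
- by apply: idom; bm.
- by apply: idom; bm.
under eq_Rintegral do rewrite -divergence.
by rewrite RintegralD ?int_f1 ?int_f2 ?addr0//; exact: idom.
Qed.

Let moment0 : M 0 = 4 * pi.
Proof.
rewrite momentE; under eq_Rintegral do rewrite expr0 mul1r.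
rewrite (integral_spherical_dom21 bms1)/=.
under eq_Rintegral => p _.
  have dcos (t : R) : is_derive (t : R) (1 : R) (fun t => - cos t) (sin t).
    by apply: is_derive_eq; rewrite opprK.
  rewrite (Rintegral_FTC2 (pi_gt0 R) (@continuous_sin R) dcos).
  rewrite cospi cos0; over.
rewrite Rintegral_cst//= lebesgue_measure_itv/= lte_fin mulr_gt0 ?pi_gt0//=.
by rewrite oppr0 addr0; ring.
Qed.

Lemma sphere_moment k (w : R) : w ^+ 2 = dot v v ->
  w * (k.+1%:R * M k) = 2 * pi * (w ^+ k.+1 - (- w) ^+ k.+1).
Proof.
move=> w2; have [n] := ubnP k; elim: n k => // n ih [|[|k]] kn.
- by rewrite moment0; ring.
- have := moment_rec 0; rewrite mul0r mul0r => /eqP.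
  rewrite mulf_eq0 pnatr_eq0/= => /eqP ->; rewrite sqrrN subrr; ring.
rewrite moment_rec/= -w2.
transitivity (w ^+ 2 * (w * (k.+1%:R * M k))); first by ring.
rewrite ih; last by rewrite -ltnS (leq_trans _ kn)// ltnW.
by rewrite !(exprS _ k.+2) !(exprS _ k.+1); move: (w ^+ k.+1) ((- w) ^+ k.+1) => a b; ring.
Qed.

End fixed_vector.

(* Archimedes' hat-box theorem, multiplied by w = |v| so as to include v = 0. *)
Lemma hat_box (q : {poly R}) (v : vec3 R) (w : R) : w ^+ 2 = dot v v ->
  w * \int[sigma]_(s in sphere R) q^`().[dot s v] = 2 * pi * (q.[w] - q.[- w]).
Proof.
move=> w2; have mS := @measurable_sphere R; have fS := surface_measure_lty mS.
have bd k := bounded_measurableX k (bounded_measurable_dot v).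
under eq_Rintegral => s _.
  rewrite (@horner_coef_wide _ (size q)); last first.
    by rewrite (leq_trans (size_poly _ _))// leq_pred.
  over.
rewrite Rintegral_bigsum//; last first.
  move=> i; apply: bounded_measurable_integrable => //.
  by apply: bounded_measurableM => //; exact: bounded_measurable_cst.
rewrite mulr_sumr (@horner_coef_wide _ (size q).+1)// (@horner_coef_wide _ (size q).+1 _ (- w))//.
(* The constant coefficient of q cancels in the difference, which shifts the index by one and
   matches the coefficients of the derivative. *)
rewrite !big_ord_recl/= !expr0 opprD addrACA subrr add0r -sumrB mulr_sumr.
apply: eq_bigr => i _; rewrite RintegralZl//; last first.
  exact: bounded_measurable_integrable.
rewrite coef_deriv -mulr_natr /bump/= add1n.
transitivity (q`_i.+1 * (w * (i.+1%:R *
    \int[sigma]_(s in sphere R) dot s v ^+ i))); first by ring.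
rewrite sphere_moment//.
by move: (w ^+ i.+1) ((- w) ^+ i.+1) => x y; ring.
Qed.

End sphere_moments.

(* On an unnamed product the sigma-finite instance is shadowed by the one for subprobabilities. *)
Definition surface_measure2 (R : realType) : set (vec3 R * vec3 R) -> \bar R :=
  (surface_measure R \x surface_measure R)%E.
Arguments surface_measure2 R : clear implicits.

HB.instance Definition _ (R : realType) := Measure.on (surface_measure2 R).

Lemma fin_num_surface_measure2 (R : realType) : fin_num_fun (surface_measure2 R).
Proof.
move=> A mA; rewrite ge0_fin_numE//; apply: (@le_lt_trans _ _ (surface_measure2 R setT)).
  by apply: le_measure => //; rewrite inE.
rewrite /surface_measure2 -setXTT [ltLHS]product_measure1E//.
by rewrite -ge0_fin_numE ?mule_ge0// fin_numM//; exact: fin_num_measure.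
Qed.

HB.instance Definition _ (R : realType) := Measure_isFinite.Build _ _ _
  (surface_measure2 R) (@fin_num_surface_measure2 R).

(** * Moments of the Hamiltonian on the phase space *)

Section phase_space_moments.
Context {R : realType}.
Local Notation sigma := (surface_measure R).
Local Notation S := (sphere R).

Lemma bounded_measurable_dot_proj d (T : measurableType d) (D : set T)
    (f g : T -> vec3 R) : measurable_fun setT f -> measurable_fun setT g ->
  (forall x, D x -> S (f x)) -> (forall x, D x -> S (g x)) ->
  bounded_measurable D (fun x => dot (f x) (g x)).
Proof.
move=> mf mg Sf Sg; split; first exact: measurable_dot.
by exists 1 => x Dx; apply: dot_norm_le1; [exact: Sf|exact: Sg].
Qed.

Lemma surface_measure_sphere : fine (sigma S) = 4 * pi.
Proof.
have w1 : (1 : R) ^+ 2 = dot (1, 0, 0) (1, 0, 0) by rewrite /dot/=; ring.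
have := sphere_moment 0 w1.
under eq_Rintegral do rewrite expr0.
rewrite Rintegral_cst; last exact: measurable_sphere.
by rewrite !expr1 !mul1r => ->; rewrite opprK; ring.
Qed.

Variables J1 J2 J3 : R.
Local Notation H := (hamiltonian J1 J2 J3).

Lemma bounded_measurable_hamiltonian : bounded_measurable (phase_space R) H.
Proof.
have m11 : measurable_fun setT (fun s : vec3 R * vec3 R * vec3 R => s.1.1).
  exact: measurableT_comp.
have m12 : measurable_fun setT (fun s : vec3 R * vec3 R * vec3 R => s.1.2).
  exact: measurableT_comp.
have m2 : measurable_fun setT (fun s : vec3 R * vec3 R * vec3 R => s.2).
  exact: measurable_snd.
have S11 (s : vec3 R * vec3 R * vec3 R) : phase_space R s -> S s.1.1.
  by move=> [[]].
have S12 (s : vec3 R * vec3 R * vec3 R) : phase_space R s -> S s.1.2.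
  by move=> [[]].
have S2 (s : vec3 R * vec3 R * vec3 R) : phase_space R s -> S s.2.
  by move=> [].
rewrite /hamiltonian; apply: bounded_measurableD; first apply: bounded_measurableD.
all: apply: bounded_measurableM; first exact: bounded_measurable_cst.
- exact: bounded_measurable_dot_proj.
- exact: bounded_measurable_dot_proj.
- exact: bounded_measurable_dot_proj.
Qed.

Lemma measurable_phase_space : measurable (phase_space R).
Proof.
by apply: measurableX; [apply: measurableX|]; exact: measurable_sphere.
Qed.

Lemma phase_space_lty : (dV R (phase_space R) < +oo)%E.
Proof.
have mS := @measurable_sphere R; have fS := surface_measure_lty mS.
rewrite /dV /phase_space [ltLHS]product_measure1E//; last exact: measurableX.
rewrite [X in (X * _)%E]product_measure1E//.
have finS : sigma S \is a fin_num by rewrite ge0_fin_numE.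
by rewrite -ge0_fin_numE ?mule_ge0// !fin_numM.
Qed.

(** With x = s1.s2 this is |J1 s2 + J2 s1|^2, a convex combination of (J1 + J2)^2 and (J1 - J2)^2.
    Its positivity lets the factor w of [hat_box] be cancelled. *)
Lemma norm_sqr_gt0 x : J1 ^+ 2 != J2 ^+ 2 -> `|x| <= 1 ->
  0 < J1 ^+ 2 + J2 ^+ 2 + 2 * J1 * J2 * x.
Proof.
move=> J12; rewrite ler_norml => /andP[x1 x2].
rewrite (_ : _ + _ = ((1 + x) * (J1 + J2) ^+ 2 + (1 - x) * (J1 - J2) ^+ 2) / 2); last by field.
have p1 : 0 < (J1 + J2) ^+ 2.
  rewrite exprn_even_gt0//=; apply: contra J12 => /eqP h.
  by rewrite -subr_eq0 subr_sqr h mulr0.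
have p2 : 0 < (J1 - J2) ^+ 2.
  rewrite exprn_even_gt0//=; apply: contra J12 => /eqP h.
  by rewrite -subr_eq0 subr_sqr h mul0r.
have q1 : 0 <= 1 + x by lra.
have q2 : 0 <= 1 - x by lra.
have r1 := mulr_ge0 q1 (ltW p1); have r2 := mulr_ge0 q2 (ltW p2).
apply: divr_gt0 => //; have [x0|x0] := leP 0 x.
  have : 0 < (1 + x) * (J1 + J2) ^+ 2 by apply: mulr_gt0 => //; lra.
  by move: r2; move: (_ * _ ^+ 2) (_ * _ ^+ 2) => ? ?; lra.
have : 0 < (1 - x) * (J1 - J2) ^+ 2 by apply: mulr_gt0 => //; lra.
by move: r1; move: (_ * _ ^+ 2) (_ * _ ^+ 2) => ? ?; lra.
Qed.

(** For fixed s1 and s2, H = s3.v + J3 x with v = J1 s2 + J2 s1 and x = s1.s2; [hat_box] integrates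
    its n-th power over s3, and the hypothesis on q says that the result divided by w = |v| is a
    polynomial in x. A second use of [hat_box], with the unit vector s1, removes s2, and s1
    contributes the area: 16 pi^3 = 2 pi * 2 pi * 4 pi. *)
Lemma phase_moment n (q : {poly R}) : J1 ^+ 2 != J2 ^+ 2 ->
  (forall x w, w ^+ 2 = J1 ^+ 2 + J2 ^+ 2 + 2 * J1 * J2 * x ->
    w * q^`().[x] = (J3 * x + w) ^+ n.+1 - (J3 * x - w) ^+ n.+1) ->
  n.+1%:R * \int[dV R]_(s in phase_space R) H s ^+ n =
  16 * pi ^+ 3 * (q.[1] - q.[-1]).
Proof.
move=> J12 hq; have mS := @measurable_sphere R; have fS := surface_measure_lty mS.
have mSS : measurable (S `*` S) by exact: measurableX.
have fSS : (surface_measure2 R (S `*` S) < +oo)%E.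
  by rewrite -ge0_fin_numE//; exact: fin_num_measure.
have bHn : bounded_measurable ((S `*` S) `*` S) (fun s => H s ^+ n).
  exact/bounded_measurableX/bounded_measurable_hamiltonian.
have -> : \int[dV R]_(s in phase_space R) H s ^+ n =
    \int[surface_measure2 R]_(z in S `*` S) \int[sigma]_(s3 in S) H (z, s3) ^+ n.
  exact: (Rintegral_prod12 (m1 := surface_measure2 R) (m2 := sigma) mSS mS fSS fS bHn).
have inner z : (S `*` S) z -> \int[sigma]_(s3 in S) H (z, s3) ^+ n =
    2 * pi / n.+1%:R * q^`().[dot z.1 z.2].
  case: z => s1 s2 [/= S1 S2]; set x := dot s1 s2.
  have x1 : `|x| <= 1 by exact: dot_norm_le1.
  have y0 := norm_sqr_gt0 J12 x1; set y := (X in 0 < X) in y0.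
  pose w := Num.sqrt y.
  have w2 : w ^+ 2 = y by rewrite sqr_sqrtr// ltW.
  have w0 : w != 0 by rewrite gt_eqF// sqrtr_gt0.
  pose v : vec3 R := (J1 * s2.1.1 + J2 * s1.1.1, J1 * s2.1.2 + J2 * s1.1.2,
    J1 * s2.2 + J2 * s1.2).
  have vv : w ^+ 2 = dot v v.
    transitivity (J1 ^+ 2 * dot s2 s2 + J2 ^+ 2 * dot s1 s1 + 2 * J1 * J2 * x).
      by move: S1 S2; rewrite /sphere/= => -> ->; rewrite !mulr1.
    by rewrite /x /v /dot/=; ring.
  have := hat_box (('X + (J3 * x)%:P) ^+ n.+1) vv.
  rewrite !horner_exp !hornerD !hornerX !hornerC deriv_exp/=.
  rewrite derivD derivX derivC addr0 mul1r.
  under eq_Rintegral => s3 _.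
    rewrite hornerMn horner_exp hornerD hornerX hornerC -mulr_natl.
    rewrite (_ : dot s3 v + J3 * x = H (s1, s2, s3)); last first.
      by rewrite /hamiltonian /x /v /dot/=; ring.
    over.
  rewrite RintegralZl//; last first.
    apply: bounded_measurable_integrable => //; apply: bounded_measurableX.
    have [mH [M HM]] := bounded_measurable_hamiltonian; split.
      by apply: measurableT_comp mH _; exact: measurable_pair1.
    by exists M => s3 S3; apply: HM; split.
  rewrite ![_ + J3 * x]addrC -(hq x w w2).
  rewrite [RHS]mulrCA => /(mulfI w0) h.
  by apply: (mulfI (_ : n.+1%:R != 0 :> R)); rewrite ?pnatr_eq0// h; field.
under eq_Rintegral => z /set_mem zS do rewrite inner//.
have bq : bounded_measurable (S `*` S) (fun z => q^`().[dot z.1 z.2]).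
  apply: bounded_measurable_horner; apply: bounded_measurable_dot_proj => //.
  - by move=> z [].
  - by move=> z [].
rewrite RintegralZl//; last exact: bounded_measurable_integrable.
have -> : \int[surface_measure2 R]_(z in S `*` S) q^`().[dot z.1 z.2] =
    \int[sigma]_(s1 in S) \int[sigma]_(s2 in S) q^`().[dot s1 s2].
  exact: (Rintegral_prod12 (m1 := sigma) (m2 := sigma) mS mS fS fS bq).
under eq_Rintegral => s1 /set_mem S1.
  under eq_Rintegral => s2 _ do rewrite dotC.
  have := hat_box q (v := s1) (w := 1); rewrite S1 expr1n mul1r => /(_ erefl) ->.
  over.
rewrite Rintegral_cst// surface_measure_sphere.
have m0 : n.+1%:R != 0 :> R by rewrite pnatr_eq0.
by move: (n.+1%:R : R) m0 => m m0; field.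
Qed.

End phase_space_moments.

(** * Polynomials that meet the hypothesis of the moment formula *)

Section polynomial_lemmas.
Context {R : realType}.

Lemma poly_antiderivative (p : {poly R}) : exists q : {poly R}, q^`() = p.
Proof.
exists (\poly_(i < (size p).+1) (p`_i.-1 / i%:R)); apply/polyP => i.
rewrite coef_deriv coef_poly ltnS; case: ltnP => [ip|pi].
  by rewrite /= -[LHS]mulr_natr divfK// pnatr_eq0.
by rewrite mul0rn nth_default.
Qed.

(* The right-hand side is odd in w; divided by w it is a polynomial in w^2, hence in x. *)
Lemma odd_part_poly (al ga de : R) n : exists p : {poly R}, forall x w,
  w ^+ 2 = al + ga * x -> w * p.[x] = (de * x + w) ^+ n - (de * x - w) ^+ n.
Proof.
(* The even part r is carried along because each step of the induction mixes the odd and the even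
   part. *)
suff [p [_ [hp _]]] : exists p r : {poly R},
    (forall x w, w ^+ 2 = al + ga * x ->
       w * p.[x] = (de * x + w) ^+ n - (de * x - w) ^+ n) /\
    (forall x w, w ^+ 2 = al + ga * x ->
       r.[x] = (de * x + w) ^+ n + (de * x - w) ^+ n) by exists p.
elim: n => [|n [p [r [hp hr]]]].
  exists 0, 2%:P; split=> x w _; first by rewrite horner0 !expr0 subrr mulr0.
  by rewrite hornerC !expr0.
exists (de *: 'X * p + r), (de *: 'X * r + (al%:P + ga *: 'X) * p).
split => x w w2; have := hp _ _ w2; have := hr _ _ w2; rewrite !exprS.
  rewrite !(hornerE, hornerZ).
  move: (_ ^+ n) (_ ^+ n) => A A' hr' hp'.
  rewrite mulrDr (_ : w * (de * x * p.[x]) = de * x * (w * p.[x])); last by ring.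
  by rewrite hp' hr'; ring.
rewrite !(hornerE, hornerZ) -w2.
move: (_ ^+ n) (_ ^+ n) => A A' hr' hp'.
rewrite (_ : w ^+ 2 * p.[x] = w * (w * p.[x])); last by ring.
by rewrite hp' hr'; ring.
Qed.

End polynomial_lemmas.

(** * From moments to exponential integrals *)

Section exp_moment_transfer.
Context {R : realType}.
Context d0 (T0 : measurableType d0) (mu0 : {measure set T0 -> \bar R})
  (D0 : set T0) (K0 : T0 -> R) (M0 : R).
Context d1 (T1 : measurableType d1) (mu1 : {measure set T1 -> \bar R})
  (D1 : set T1) (K1 K2 : T1 -> R) (M1 M2 : R).
Hypotheses (mD0 : measurable D0) (fD0 : (mu0 D0 < +oo)%E)
  (mK0 : measurable_fun D0 K0) (KM0 : forall s, D0 s -> `|K0 s| <= M0).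
Hypotheses (mD1 : measurable D1) (fD1 : (mu1 D1 < +oo)%E)
  (mK1 : measurable_fun D1 K1) (KM1 : forall s, D1 s -> `|K1 s| <= M1)
  (mK2 : measurable_fun D1 K2) (KM2 : forall s, D1 s -> `|K2 s| <= M2).
Variable C : R.
Local Notation Phi0 := (exp_moment mu0 D0 K0).
Local Notation Phi1 := (exp_moment mu1 D1 K1).
Local Notation Phi2 := (exp_moment mu1 D1 K2).
Hypothesis moments : forall n,
  n.+1%:R * Phi0 n 0 = C * (Phi1 n.+1 0 - Phi2 n.+1 0).

(** Comparison of the coefficients of x^(n+1) / (n+1)!. The constant terms on the right cancel, both
    being the measure of D1; this matches the factor x on the left. *)
Lemma exp_moment_transfer x : x * Phi0 0 x = C * (Phi1 0 x - Phi2 0 x).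
Proof.
have h0 := exp_moment_series mD0 fD0 mK0 KM0 (x := x).
have h1 := exp_moment_series mD1 fD1 mK1 KM1 (x := x).
have h2 := exp_moment_series mD1 fD1 mK2 KM2 (x := x).
pose f0 n := x * series (fun n => x ^+ n / n`!%:R * Phi0 n 0) n.
pose f1 n := C * (series (fun n => x ^+ n / n`!%:R * Phi1 n 0) n.+1 -
    series (fun n => x ^+ n / n`!%:R * Phi2 n 0) n.+1).
have {}h0 : f0 n @[n --> \oo] --> x * Phi0 0 x.
  by apply: cvgM => //; exact: cvg_cst.
have {h1 h2}h1 : f1 n @[n --> \oo] --> C * (Phi1 0 x - Phi2 0 x).
  apply: cvgM; first exact: cvg_cst.
  rewrite -cvg_shiftS in h1; rewrite -cvg_shiftS in h2.
  exact: cvgB.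
suff fE : f0 = f1 by rewrite fE in h0; exact: (cvg_unique _ h0 h1).
apply/funext => n; rewrite /f0 /f1 /series/= !big_nat_recl// !expr0.
have e0 : Phi1 0 0 = Phi2 0 0.
  by apply: eq_Rintegral => s _; rewrite !expr0 !mul0r.
rewrite e0 opprD addrACA subrr add0r -sumrB !mulr_sumr.
apply: eq_bigr => i _.
transitivity (x ^+ i.+1 / (i.+1)`!%:R * (i.+1%:R * Phi0 i 0)).
  rewrite exprS factS natrM; move: (x ^+ i) => y.
  have : i`!%:R != 0 :> R by rewrite pnatr_eq0 -lt0n fact_gt0.
  have : i.+1%:R != 0 :> R by rewrite pnatr_eq0.
  by move: (i`!%:R : R) (i.+1%:R : R) => u v u0 v0; field; rewrite ?u0 ?v0.
by rewrite moments; move: (x ^+ i.+1) => y; ring.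
Qed.

End exp_moment_transfer.

(** * Reduction to one-dimensional integrals *)

Section reduction_to_interval.
Context {R : realType}.
Local Notation mu := (@lebesgue_measure R).
Local Notation r2 := (Num.sqrt 2 : R).
Local Notation J1 := (- (1 / 2) : R).
Local Notation J2 := (1 / 2 + r2 / 2 : R).
Local Notation J3 := (r2 / 2 : R).
Local Notation H := (hamiltonian J1 J2 J3).

Lemma sqr_sqrt2 : r2 * r2 = 2.
Proof. by rewrite -expr2 sqr_sqrtr. Qed.

Lemma sqrt2_gt : 7 / 5 < r2.
Proof.
have h := sqr_sqrt2; have h0 : 0 <= r2 by exact: sqrtr_ge0.
by rewrite ltNge; apply/negP => h1; nra.
Qed.

Lemma sqrt2_lt : r2 < 17 / 12.
Proof.
have h := sqr_sqrt2; have h0 : 0 <= r2 by exact: sqrtr_ge0.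
by rewrite ltNge; apply/negP => h1; nra.
Qed.

(* The range of w = |J1 s2 + J2 s1| is [wmin, wmax], and J3 s1.s2 = 1 - kappa w^2. *)
Definition kappa : R := 2 - r2.
Definition wmin : R := r2 / 2.
Definition wmax : R := 1 + r2 / 2.
(** The extreme values of H over s3, namely J3 s1.s2 + w and J3 s1.s2 - w; these are the polynomials
    P and Q. *)
Definition energy_max (w : R) : R := 1 - kappa * w ^+ 2 + w.
Definition energy_min (w : R) : R := 1 - kappa * w ^+ 2 - w.
Local Notation W := `[wmin, wmax]%classic.

(** It places the vertices of the two parabolas, 1 / (2 kappa) in absolute value, at half the right
    endpoint. *)
Lemma kappa_wmax : kappa * wmax = 1.
Proof.
have := sqr_sqrt2; rewrite /kappa /wmax => h.
rewrite (_ : _ * _ = 2 - r2 * r2 / 2); last by field.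
by rewrite h; lra.
Qed.

Lemma energy_max_wmax : energy_max wmax = 1.
Proof. by rewrite /energy_max expr2 mulrA kappa_wmax; ring. Qed.

Lemma energy_min_wmax : energy_min wmax = - (1 + r2).
Proof. by rewrite /energy_min expr2 mulrA kappa_wmax /wmax; lra. Qed.

Lemma energy_max_wmin : energy_max wmin = r2.
Proof.
have h2 := sqr_sqrt2; rewrite /energy_max /wmin /kappa.
apply/eqP; rewrite -subr_eq0; apply/eqP.
transitivity ((r2 * r2 - 2) * (r2 / 4 - 1 / 2)); last by rewrite h2 subrr mul0r.
by field.
Qed.

Lemma energy_min_wmin : energy_min wmin = 0.
Proof.
have h2 := sqr_sqrt2; rewrite /energy_min /wmin /kappa.
transitivity ((r2 * r2 - 2) * (r2 / 4 - 1 / 2)); last by rewrite h2 subrr mul0r.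
by field.
Qed.

Lemma wmin_lt_wmax : wmin < wmax.
Proof. by rewrite /wmin /wmax; lra. Qed.

Lemma continuous_energy_max : continuous energy_max.
Proof.
move=> w; rewrite /energy_max; apply: cvgD => //; apply: cvgB; first exact: cvg_cst.
by apply: cvgM; [exact: cvg_cst|rewrite expr2; apply: cvgM].
Qed.

Lemma continuous_energy_min : continuous energy_min.
Proof.
move=> w; rewrite /energy_min; apply: cvgB => //; apply: cvgB; first exact: cvg_cst.
by apply: cvgM; [exact: cvg_cst|rewrite expr2; apply: cvgM].
Qed.

Lemma energy_max_le w : W w -> `|energy_max w| <= 10.
Proof.
have := sqrt2_gt; have := sqrt2_lt; rewrite /= in_itv/= /energy_max /wmin /wmax /kappa.
move: r2 => s ? ? /andP[? ?]; rewrite expr2 ler_norml; apply/andP; split; nra.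
Qed.

Lemma energy_min_le w : W w -> `|energy_min w| <= 10.
Proof.
have := sqrt2_gt; have := sqrt2_lt; rewrite /= in_itv/= /energy_min /wmin /wmax /kappa.
move: r2 => s ? ? /andP[? ?]; rewrite expr2 ler_norml; apply/andP; split; nra.
Qed.

(** The divisor is - J1 J2, the Jacobian factor in w dw = J1 J2 dx. *)
Definition interval_const : R := 16 * pi ^+ 3 / ((1 + r2) / 4).

Lemma interval_const_gt0 : 0 < interval_const.
Proof.
by rewrite /interval_const divr_gt0 ?mulr_gt0 ?exprn_gt0 ?pi_gt0.
Qed.

Lemma exp_moment0E d (T : measurableType d) (nu : {measure set T -> \bar R}) D
    (K : T -> R) n : exp_moment nu D K n 0 = \int[nu]_(x in D) K x ^+ n.
Proof. by apply: eq_Rintegral => x _; rewrite mul0r expR0 mulr1. Qed.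

Lemma J12_neq : J1 ^+ 2 != J2 ^+ 2.
Proof.
rewrite sqrrN eqrXn2 ?divr_ge0//.
by apply/eqP; have := sqrt2_gt; lra.
Qed.

(** Substitute w^2 = J1^2 + J2^2 + 2 J1 J2 x in the integral of the derivative of q over [-1, 1].
    The Jacobian supplies exactly the factor w that turns this derivative into the difference of the
    powers of [energy_max] and [energy_min]. *)
Lemma phase_interval_moments n :
  n.+1%:R * exp_moment (dV R) (phase_space R) H n 0 = interval_const *
    (exp_moment mu W energy_max n.+1 0 - exp_moment mu W energy_min n.+1 0).
Proof.
have [p hp] := odd_part_poly (J1 ^+ 2 + J2 ^+ 2) (2 * J1 * J2) J3 n.+1.
have [q qp] := poly_antiderivative p; rewrite -qp in hp.
rewrite !exp_moment0E (phase_moment J12_neq hp) -RintegralB//; last 2 first.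
- apply: continuous_itv_integrable => w.
  apply: (@continuous_comp _ _ _ energy_max (fun x => x ^+ n.+1)).
    exact: continuous_energy_max.
  exact: exprn_continuous.
- apply: continuous_itv_integrable => w.
  apply: (@continuous_comp _ _ _ energy_min (fun x => x ^+ n.+1)).
    exact: continuous_energy_min.
  exact: exprn_continuous.
have [L LE] : exists L : R, L = (1 + r2) / 4 by exists ((1 + r2) / 4).
have L0 : L != 0 by rewrite gt_eqF// LE; have := sqrt2_gt; lra.
(* The solution x of w^2 = J1^2 + J2^2 + 2 J1 J2 x: here J1^2 + J2^2 equals [wmax] and L equals - J1
   J2. It decreases from 1 at [wmin] to -1 at [wmax]. *)
pose xi (w : R) := (wmax - w ^+ 2) / (2 * L).
have h2 := sqr_sqrt2.
have dxi w : is_derive (w : R) (1 : R) xi (- w / L).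
  rewrite /xi; apply: is_derive_eq; rewrite /GRing.scale/=.
  by field; rewrite L0.
have J3xi w : J3 * xi w = 1 - kappa * w ^+ 2.
  rewrite /xi; apply: (mulIf L0); rewrite [LHS](_ : _ = r2 / 4 * (wmax - w ^+ 2)); last by field.
  rewrite LE /wmax /kappa; apply/eqP; rewrite -subr_eq0; apply/eqP.
  transitivity ((r2 * r2 - 2) * (1/8 - w ^+ 2 / 4)); last by rewrite h2 subrr mul0r.
  by field.
have w2xi w : w ^+ 2 = J1 ^+ 2 + J2 ^+ 2 + 2 * J1 * J2 * xi w.
  rewrite (_ : 2 * J1 * J2 * xi w = - (wmax - w ^+ 2)); last first.
    transitivity (- (1 + r2) / 2 * xi w); first by field.
    rewrite (_ : 1 + r2 = 4 * L); last by rewrite LE; field.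
    by rewrite /xi; field.
  rewrite opprB addrCA -[LHS]addr0; congr (_ + _); rewrite /wmax.
  apply/eqP; rewrite eq_sym -subr_eq0 subr0; apply/eqP.
  transitivity ((r2 * r2 - 2) / 4); last by rewrite h2 subrr mul0r.
  by field.
have hE w : energy_max w ^+ n.+1 - energy_min w ^+ n.+1 = w * q^`().[xi w].
  by rewrite (hp _ _ (w2xi w)) J3xi.
under [in RHS]eq_Rintegral do rewrite hE.
have dF w : is_derive (w : R) (1 : R) (fun w => - L * q.[xi w]) (w * q^`().[xi w]).
  have dq : is_derive (w : R) (1 : R) (fun w => q.[xi w]) (- w / L * q^`().[xi w]).
    apply: (is_derive_eq (is_derive1_comp (is_derive_poly q (xi w)) (dxi w))).
    by rewrite /GRing.scale/= mulrC.
  apply: (is_derive_eq (is_derive_fM (is_derive_cst (- L) w 1) dq)).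
  by rewrite /cst/=; field.
have cF : continuous (fun w : R => w * q^`().[xi w]).
  move=> w; apply: cvgM => //.
  apply: (@continuous_comp _ _ _ xi (horner q^`())); last exact: continuous_horner.
  by apply: differentiable_continuous; apply/derivable1_diffP.
rewrite (Rintegral_FTC2 wmin_lt_wmax cF dF).
have -> : xi wmax = -1.
  rewrite /xi; apply: (mulIf L0); rewrite [LHS](_ : _ = (wmax - wmax ^+ 2) / 2); last by field.
  rewrite LE /wmax; apply/eqP; rewrite -subr_eq0; apply/eqP.
  transitivity ((2 - r2 * r2) / 8); last by rewrite h2 subrr mul0r.
  by field.
have -> : xi wmin = 1.
  rewrite /xi; apply: (mulIf L0); rewrite [LHS](_ : _ = (wmax - wmin ^+ 2) / 2); last by field.
  rewrite LE /wmax /wmin; apply/eqP; rewrite -subr_eq0; apply/eqP.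
  transitivity ((2 - r2 * r2) / 8); last by rewrite h2 subrr mul0r.
  by field.
by rewrite /interval_const -LE; field.
Qed.

Definition interval_partition (x : R) : R :=
  exp_moment mu W energy_max 0 x - exp_moment mu W energy_min 0 x.

Lemma partition_interval x :
  x * exp_moment (dV R) (phase_space R) H 0 x = interval_const * interval_partition x.
Proof.
have [mH [M HM]] := bounded_measurable_hamiltonian J1 J2 J3.
have mP := @measurable_phase_space R; have fP := @phase_space_lty R.
have mHP : measurable_fun (phase_space R) H by exact: measurable_funTS.
have mW : measurable W by exact: measurable_itv.
have fW := lebesgue_measure_segment_lty wmin wmax.
have m1 : measurable_fun W energy_max.
  by apply: measurable_funTS; apply: continuous_measurable_fun; exact: continuous_energy_max.
have m2 : measurable_fun W energy_min.
  by apply: measurable_funTS; apply: continuous_measurable_fun; exact: continuous_energy_min.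
have h := exp_moment_transfer mP fP mHP HM.
have {}h := h _ _ mu W energy_max energy_min _ _ mW fW m1 energy_max_le m2 energy_min_le.
exact: (h _ phase_interval_moments).
Qed.

End reduction_to_interval.

(** * Asymptotics *)

Section decay.
Context {R : realType}.
Implicit Types (f g : R -> R) (m n : nat).

(** O(x^-n) with an explicit exponent, so that orders add under products. Behaviour at -oo is
    treated by composing with the opposite. *)
Definition decays n f := exists C, \forall x \near +oo, `|f x| <= C * x ^- n.

Lemma decays_near n f g : {near +oo, f =1 g} -> decays n f -> decays n g.
Proof.
move=> fg [C hC]; exists C; near=> x.
by rewrite -(near fg x)//; near: x.
Unshelve. all: by end_near. Qed.

Lemma decaysW m n f : (m <= n)%N -> decays n f -> decays m f.
Proof.
move=> mn [C hC]; exists C; near=> x.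
have x1 : 1 <= x by near: x; exact: nbhs_pinfty_ge.
have x0 : 0 < x by exact: lt_le_trans x1.
have fx : `|f x| <= C * x ^- n by near: x.
apply: (le_trans fx).
have C0 : 0 <= C.
  have : 0 <= C * x ^- n by exact: (le_trans _ fx).
  by rewrite pmulr_lge0// invr_gt0 exprn_gt0.
by rewrite ler_wpM2l// lef_pV2 ?posrE ?exprn_gt0// ler_weXn2l.
Unshelve. all: by end_near. Qed.

Lemma decaysD n f g : decays n f -> decays n g -> decays n (fun x => f x + g x).
Proof.
move=> [C hC] [D hD]; exists (C + D); near=> x.
apply: le_trans (ler_normD _ _) _; rewrite mulrDl lerD//; near: x => //.
Unshelve. all: by end_near. Qed.

Lemma decaysM m n f g : decays m f -> decays n g ->
  decays (m + n) (fun x => f x * g x).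
Proof.
move=> [C hC] [D hD]; exists (C * D); near=> x.
rewrite normrM exprD invfM mulrACA ler_pM//; near: x => //.
Unshelve. all: by end_near. Qed.

Lemma decays_cst (c : R) : decays 0 (fun=> c).
Proof. by exists `|c|; apply: nearW => x; rewrite expr0 invr1 mulr1. Qed.

Lemma decaysZ n (c : R) f : decays n f -> decays n (fun x => c * f x).
Proof. by move=> /(decaysM (decays_cst c)). Qed.

Lemma decaysN n f : decays n f -> decays n (fun x => - f x).
Proof. by move=> [C hC]; exists C; near=> x; rewrite normrN; near: x.
Unshelve. all: by end_near. Qed.

Lemma decaysB n f g : decays n f -> decays n g -> decays n (fun x => f x - g x).
Proof. by move=> hf /decaysN; exact: decaysD. Qed.

Lemma decaysV : decays 1 (fun x : R => x^-1).
Proof.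
exists 1; near=> x; rewrite mul1r expr1 ger0_norm// invr_ge0.
by near: x; exact: nbhs_pinfty_ge.
Unshelve. all: by end_near. Qed.

Lemma decays_exprM k n f : decays (n + k) f -> decays n (fun x => x ^+ k * f x).
Proof.
move=> [C hC]; exists C; near=> x.
have x0 : 0 < x by near: x; exact: nbhs_pinfty_gt.
rewrite normrM (ger0_norm (exprn_ge0 _ (ltW x0))) -ler_pdivlMl ?exprn_gt0//.
have : `|f x| <= C * x ^- (n + k) by near: x.
by rewrite exprD invfM mulrA [X in _ -> _ <= X]mulrC.
Unshelve. all: by end_near. Qed.

Lemma decays_div n f g (c : R) : 0 < c -> (\forall x \near +oo, c <= `|g x|) ->
  decays n f -> decays n (fun x => f x / g x).
Proof.
move=> c0 hg [C hC]; exists (C / c); near=> x.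
have gx : c <= `|g x| by near: x.
have fx : `|f x| <= C * x ^- n by near: x.
rewrite normrM normfV mulrAC ler_pM ?invr_ge0 ?normr_ge0//.
by rewrite lef_pV2 ?posrE// (lt_le_trans c0).
Unshelve. all: by end_near. Qed.

Lemma decays_le n f g : (\forall x \near +oo, `|f x| <= `|g x|) -> decays n g ->
  decays n f.
Proof.
move=> fg [C hC]; exists C; near=> x; apply: (@le_trans _ _ `|g x|).
  by near: x.
by near: x.
Unshelve. all: by end_near. Qed.

Lemma decays_expR n (e : R) : 0 < e -> decays n (fun x => expR (- (e * x))).
Proof.
(* Order n + 1 comes directly from exp(y) >= 1 + y^(n+1) / (n+1)!, and covers n = 0 as well. *)
move=> e0; apply: (@decaysW _ n.+1) => //.
exists (n.+1`!%:R / e ^+ n.+1); near=> x.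
have x0 : 0 < x by near: x; exact: nbhs_pinfty_gt.
have ex0 : 0 < e * x by exact: mulr_gt0.
rewrite ger0_norm ?expR_ge0// expRN.
rewrite (_ : _ * _ = ((e * x) ^+ n.+1 / n.+1`!%:R)^-1); last first.
  have f0 : n.+1`!%:R != 0 :> R by rewrite pnatr_eq0 -lt0n fact_gt0.
  have xn0 : x ^+ n.+1 != 0 by rewrite gt_eqF ?exprn_gt0.
  have en0 : e ^+ n.+1 != 0 by rewrite gt_eqF ?exprn_gt0.
  rewrite exprMn; move: f0 xn0 en0.
  move: (n.+1`!%:R : R) (x ^+ n.+1) (e ^+ n.+1) => A B D A0 B0 D0.
  by field; rewrite A0 B0 D0.
rewrite lef_pV2 ?posrE ?expR_gt0//; last first.
  by rewrite divr_gt0 ?exprn_gt0// ltr0n fact_gt0.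
by apply: (le_trans _ (expR_ge1Dxn n (ltW ex0))); rewrite lerDr.
Unshelve. all: by end_near. Qed.

Lemma decays_norm n f : decays n f -> decays n (fun x => `|f x|).
Proof. by apply: decays_le; apply: nearW => x; rewrite normr_id. Qed.

Lemma decaysX n f : decays 1 f -> decays n (fun x => f x ^+ n).
Proof.
move=> hf; elim: n => [|n ih].
  by apply: (decays_near _ (decays_cst 1)); apply: nearW => x; rewrite expr0.
by apply: (decays_near _ (decaysM hf ih)); apply: nearW => x; rewrite exprS.
Qed.

Lemma decays0X n f : decays 0 f -> decays 0 (fun x => f x ^+ n).
Proof.
move=> hf; elim: n => [|n ih].
  by apply: (decays_near _ (decays_cst 1)); apply: nearW => x; rewrite expr0.
by apply: (decays_near _ (decaysM hf ih)); apply: nearW => x; rewrite exprS.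
Qed.

Lemma decays1_small f (e : R) : 0 < e -> decays 1 f -> \forall x \near +oo, `|f x| <= e.
Proof.
move=> e0 [C hC]; near=> x.
have x0 : 0 < x by near: x; exact: nbhs_pinfty_gt.
have fx : `|f x| <= C * x ^- 1 by near: x.
have Cx : C / e <= x by near: x; apply: nbhs_pinfty_ge; exact: num_real.
apply: (le_trans fx); rewrite expr1 ler_pdivrMr// mulrC.
by rewrite -ler_pdivrMr.
Unshelve. all: by end_near. Qed.

(** The difference quotient stays within 1 of its limit near 0. This yields the remainder at high
    temperature. *)
Lemma derivable_near0_le f : derivable f 0 1 ->
  exists C, \forall h \near 0, `|f h - f 0| <= C * `|h|.
Proof.
move=> /cvg_ex[l hl]; exists (`|l| + 1).
have /cvgr_dist_lt /(_ 1 ltr01) h1 := hl.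
rewrite near_withinE in h1.
near=> h; have [->|h0] := eqVneq h 0; first by rewrite subrr !normr0 mulr0.
have : `|l - h^-1 *: (f (h *: 1 + 0) - f 0)| < 1.
  by move: h0; near: h; apply: filterS h1 => k hk k0; exact: hk.
rewrite addr0 /GRing.scale/= mulr1 => h2.
have h3 : `|h^-1 * (f h - f 0)| <= `|l| + 1.
  have := ler_normB l (l - h^-1 * (f h - f 0)); rewrite opprB addrCA subrr addr0.
  by move=> /le_trans; apply; rewrite lerD2l ltW.
move: h3; rewrite normrM normfV -ler_pdivlMl ?invr_gt0 ?normr_gt0// invrK.
by rewrite mulrC.
Unshelve. all: by end_near. Qed.

End decay.

(** * The first-order differential equation for the one-dimensional integral *)

Section interval_ode.
Context {R : realType}.
Local Notation mu := (@lebesgue_measure R).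
Local Notation r2 := (Num.sqrt 2 : R).
Local Notation a := (@wmin R).
Local Notation b := (@wmax R).
Local Notation k := (@kappa R).
Local Notation W := `[a, b]%classic.
Local Notation EP := (exp_moment mu W (@energy_max R)).
Local Notation EQ := (exp_moment mu W (@energy_min R)).
(** The common vertex value: that of [energy_max] at b / 2 and of [energy_min] at - b / 2. *)
Local Notation mustar := (1 + b / 4).

Lemma integrable_energy_max j x : mu.-integrable W
  (EFin \o (fun w => energy_max w ^+ j * expR (x * energy_max w))).
Proof.
apply: (integrable_exp_moment _ (lebesgue_measure_segment_lty _ _) _ (@energy_max_le R)).
- exact: measurable_itv.
- apply: measurable_funTS; apply: continuous_measurable_fun.
  exact: continuous_energy_max.
Qed.

Lemma integrable_energy_min j x : mu.-integrable W
  (EFin \o (fun w => energy_min w ^+ j * expR (x * energy_min w))).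
Proof.
apply: (integrable_exp_moment _ (lebesgue_measure_segment_lty _ _) _ (@energy_min_le R)).
- exact: measurable_itv.
- apply: measurable_funTS; apply: continuous_measurable_fun.
  exact: continuous_energy_min.
Qed.

Lemma is_derive_exp_energy_max j x : is_derive (x : R) (1 : R) (EP j) (EP j.+1 x).
Proof.
apply: (is_derive_exp_moment _ (lebesgue_measure_segment_lty _ _) _ (@energy_max_le R)).
- exact: measurable_itv.
- apply: measurable_funTS; apply: continuous_measurable_fun.
  exact: continuous_energy_max.
Qed.

Lemma is_derive_exp_energy_min j x : is_derive (x : R) (1 : R) (EQ j) (EQ j.+1 x).
Proof.
apply: (is_derive_exp_moment _ (lebesgue_measure_segment_lty _ _) _ (@energy_min_le R)).
- exact: measurable_itv.
- apply: measurable_funTS; apply: continuous_measurable_fun.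
  exact: continuous_energy_min.
Qed.

(* Integration by parts against the vertex sg * b / 2 of the parabola K. *)
Lemma exp_moment_parabola (K : R -> R) (sg x : R) : sg ^+ 2 = 1 ->
  (forall w, K w = 1 - k * w ^+ 2 + sg * w) ->
  (forall j, mu.-integrable W (EFin \o (fun w => K w ^+ j * expR (x * K w)))) ->
  exp_moment mu W K 0 x +
    2 * x * (exp_moment mu W K 1 x - mustar * exp_moment mu W K 0 x) =
  (b - sg * b / 2) * expR (x * K b) - (a - sg * b / 2) * expR (x * K a).
Proof.
move=> sg2 KE iK; have kb := @kappa_wmax R.
have dK w : is_derive (w : R) (1 : R) K (sg - 2 * k * w).
  rewrite (_ : K = fun w => 1 - k * w ^+ 2 + sg * w); last exact/funext.
  by apply: is_derive_eq; rewrite /GRing.scale/=; ring.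
have dexp w : is_derive (w : R) (1 : R) (fun w => expR (x * K w))
    (x * (sg - 2 * k * w) * expR (x * K w)).
  have h := dK w; apply: is_derive_eq; rewrite /GRing.scale/=.
  by ring.
(* A parabola with vertex v satisfies (w - v) K'(w) = 2 (K(w) - K(v)), and K(v) is [mustar] for both
   signs. *)
have dF w : is_derive (w : R) (1 : R)
   (fun w => (w - sg * b / 2) * expR (x * K w))
   ((1 - 2 * x * mustar) * expR (x * K w) + 2 * x * (K w * expR (x * K w))).
  have dl : is_derive (w : R) (1 : R) (fun w => w - sg * b / 2) 1.
    by apply: is_derive_eq; rewrite oppr0 addr0.
  apply: (is_derive_eq (is_derive_fM dl (dexp w))).
  rewrite KE; set E := expR _; apply/eqP; rewrite -subr_eq0; apply/eqP.
  rewrite [LHS](_ : _ = x * E * (w * sg * (k * b - 1) + b / 2 * (1 - sg ^+ 2))); last first.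
    by field.
  by rewrite kb sg2 !subrr !mulr0 addr0 mulr0.
have cK : continuous K.
  by move=> w; apply: differentiable_continuous; apply/derivable1_diffP.
have ce : continuous (fun w : R => expR (x * K w)).
  by move=> w; apply: differentiable_continuous; apply/derivable1_diffP.
have cF : continuous (fun w : R => (1 - 2 * x * mustar) * expR (x * K w) +
    2 * x * (K w * expR (x * K w))).
  move=> w; apply: cvgD; apply: cvgM; first exact: cvg_cst.
  - exact: ce.
  - exact: cvg_cst.
  - by apply: cvgM; [exact: cK|exact: ce].
rewrite -(Rintegral_FTC2 (@wmin_lt_wmax R) cF dF).
have i0 : mu.-integrable W (EFin \o (fun w => expR (x * K w))).
  by apply: eq_integrable (iK 0%N) => // w _ /=; rewrite expr0 mul1r.
have i1 : mu.-integrable W (EFin \o (fun w => K w * expR (x * K w))).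
  by apply: eq_integrable (iK 1%N) => // w _ /=; rewrite expr1.
rewrite RintegralD//; last 2 first.
- apply: continuous_itv_integrable => w; apply: cvgM; [exact: cvg_cst|exact: ce].
- apply: continuous_itv_integrable => w; apply: cvgM; first exact: cvg_cst.
  by apply: cvgM; [exact: cK|exact: ce].
rewrite !RintegralZl// /exp_moment.
under [X in X + _ = _]eq_Rintegral do rewrite expr0 mul1r.
under [X in _ * (_ - _ * X)]eq_Rintegral do rewrite expr0 mul1r.
under [X in _ * (X - _)]eq_Rintegral do rewrite expr1.
by ring.
Qed.

Definition gap (j : nat) (x : R) : R := EP j x - EQ j x.

Lemma is_derive_gap j x : is_derive (x : R) (1 : R) (gap j) (gap j.+1 x).
Proof. exact: (is_deriveB (is_derive_exp_energy_max j x) (is_derive_exp_energy_min j x)). Qed.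

Definition boundary (x : R) : R := b / 2 * expR x - (a - b / 2) * expR (r2 * x)
  - 3 * b / 2 * expR (- ((1 + r2) * x)) + (a + b / 2).

Definition boundary' (x : R) : R := b / 2 * expR x
  - r2 * (a - b / 2) * expR (r2 * x)
  + (1 + r2) * (3 * b / 2) * expR (- ((1 + r2) * x)).

Lemma is_derive_boundary x : is_derive (x : R) (1 : R) boundary (boundary' x).
Proof.
rewrite /boundary /boundary'; apply: is_derive_eq; rewrite /GRing.scale/=.
by ring.
Qed.

(** The same [mustar] occurs for both parabolas, so the two integrations by parts apply the same
    operator and can be subtracted; [boundary] collects the four endpoint terms. *)
Lemma gap_ode x : boundary x = gap 0 x + 2 * x * (gap 1 x - mustar * gap 0 x).
Proof.
have hP := exp_moment_parabola (K := @energy_max R) (sg := 1) (x := x).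
have hQ := exp_moment_parabola (K := @energy_min R) (sg := -1) (x := x).
rewrite expr1n in hP; rewrite sqrrN expr1n in hQ.
have {}hP := hP erefl (fun w => _) (integrable_energy_max ^~ x).
have {}hQ := hQ erefl (fun w => _) (integrable_energy_min ^~ x).
have eP : forall w : R, energy_max w = 1 - k * w ^+ 2 + 1 * w.
  by move=> w; rewrite mul1r.
have eQ : forall w : R, energy_min w = 1 - k * w ^+ 2 + -1 * w.
  by move=> w; rewrite mulN1r.
have {}hP := hP eP; have {}hQ := hQ eQ.
rewrite energy_max_wmax energy_max_wmin mulr1 in hP.
rewrite energy_min_wmax energy_min_wmin mulr0 expR0 mulrN in hQ.
rewrite /gap /boundary (mulrC r2) (mulrC (1 + r2)).
transitivity ((EP 0 x + 2 * x * (EP 1 x - mustar * EP 0 x)) -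
  (EQ 0 x + 2 * x * (EQ 1 x - mustar * EQ 0 x))); last first.
  by move: (EP 0 x) (EQ 0 x) (EP 1 x) (EQ 1 x) => p0 q0 p1 q1; ring.
by rewrite hP hQ; field.
Qed.

Lemma is_derive_unique (f : R -> R) (x d1 d2 : R) :
  is_derive (x : R) (1 : R) f d1 -> is_derive (x : R) (1 : R) f d2 -> d1 = d2.
Proof. by move=> h1 h2; rewrite -(@derive_val _ _ _ _ _ _ _ h1) (@derive_val _ _ _ _ _ _ _ h2). Qed.

(** The derivative of [gap_ode]; it eliminates [gap 2] from the second logarithmic derivative. *)
Lemma gap_ode' x : boundary' x = gap 1 x + 2 * (gap 1 x - mustar * gap 0 x)
  + 2 * x * (gap 2 x - mustar * gap 1 x).
Proof.
have h0 := is_derive_gap 0 x; have h1 := is_derive_gap 1 x.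
apply: (is_derive_unique (is_derive_boundary x)).
rewrite (_ : boundary = fun x => gap 0 x + 2 * x * (gap 1 x - mustar * gap 0 x)); last first.
  by apply/funext => y; exact: gap_ode.
by apply: is_derive_eq; rewrite /GRing.scale/=; ring.
Qed.

End interval_ode.

(** * The variance of the energy in terms of the one-dimensional integral *)

Section specific_heat_formula.
Context {R : realType}.
Local Notation r2 := (Num.sqrt 2 : R).
Local Notation b := (@wmax R).
Local Notation H := (hamiltonian (- (1 / 2)) (1 / 2 + r2 / 2) (r2 / 2)).
Local Notation Phi := (exp_moment (dV R) (phase_space R) H).
Local Notation C := (@interval_const R).

Lemma is_derive_phase_moment j x : is_derive (x : R) (1 : R) (Phi j) (Phi j.+1 x).
Proof.
have [mH [M HM]] := bounded_measurable_hamiltonian (- (1 / 2) : R) (1 / 2 + r2 / 2) (r2 / 2).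
apply: (is_derive_exp_moment _ (@phase_space_lty R) _ HM).
- exact: measurable_phase_space.
- exact: measurable_funTS.
Qed.

(** At x = 0 the three spins are independent and uniform; the normalized second moment is (J1^2 +
    J2^2 + J3^2) / 3 = (3 + r2) / 6. *)
Lemma hamiltonian_moments : [/\ Phi 0 0 = 64 * pi ^+ 3, Phi 1 0 = 0 &
  Phi 2 0 = 64 * pi ^+ 3 * ((3 + r2) / 6)].
Proof.
have h2 := @sqr_sqrt2 R.
(* For n <= 2 a cubic q suffices, and its even coefficient c2 drops out of q(1) - q(-1). *)
have pm n (c1 c2 c3 : R) (hq : forall x w, w ^+ 2 = (- (1 / 2)) ^+ 2 + (1 / 2 + r2 / 2) ^+ 2
    + 2 * - (1 / 2) * (1 / 2 + r2 / 2) * x ->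
    w * (c1 + 2 * c2 * x + 3 * c3 * x ^+ 2) =
    (r2 / 2 * x + w) ^+ n.+1 - (r2 / 2 * x - w) ^+ n.+1) :
    n.+1%:R * Phi n 0 = 32 * pi ^+ 3 * (c1 + c3).
  pose q : {poly R} := c1 *: 'X + c2 *: 'X^2 + c3 *: 'X^3.
  have dq x : q^`().[x] = c1 + 2 * c2 * x + 3 * c3 * x ^+ 2.
    by rewrite /q !poly.derivE !hornerE /=; ring.
  rewrite exp_moment0E (@phase_moment R _ _ _ n q (@J12_neq R)).
    by rewrite /q !hornerE /= ?expr1n ?mulr1; ring.
  by move=> x w w2; rewrite dq; exact: hq.
split.
- rewrite -[LHS]mul1r [LHS](pm 0%N 2 0 0); first by ring.
  by move=> x w _; ring.
- apply: (@mulfI _ (2 : R)); first by rewrite pnatr_eq0.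
  rewrite [LHS](pm 1%N 0 r2 0); first by ring.
  by move=> x w _; field.
- pose al : R := (- (1 / 2)) ^+ 2 + (1 / 2 + r2 / 2) ^+ 2.
  pose ga : R := 2 * - (1 / 2) * (1 / 2 + r2 / 2).
  have := pm 2%N (2 * al) ga (2 * (r2 / 2) ^+ 2) => h3.
  apply: (@mulfI _ (3 : R)); first by rewrite pnatr_eq0.
  rewrite h3.
    rewrite /al; transitivity (32 * pi ^+ 3 * (1 + r2 + r2 * r2)); first by field.
    by rewrite h2; field.
  by move=> x w w2; have {}w2 : w ^+ 2 = al + ga * x by []; move: w2 => w2;
    transitivity (w * (6 * (r2 / 2) ^+ 2 * x ^+ 2 + 2 * w ^+ 2)); [rewrite w2; ring|ring].
Qed.

(** The second logarithmic derivative of [Phi 0], which is the variance of H under the Gibbs weight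
    exp(x H). *)
Definition energy_variance (x : R) : R :=
  (Phi 2 x * Phi 0 x - Phi 1 x ^+ 2) / Phi 0 x ^+ 2.

Lemma phase_partition_gt0 x : 0 < Phi 0 x.
Proof.
have [mH [M HM]] := bounded_measurable_hamiltonian (- (1 / 2) : R) (1 / 2 + r2 / 2) (r2 / 2).
have [p0 _ _] := hamiltonian_moments.
have mP := @measurable_phase_space R; have fP := @phase_space_lty R.
have mHP : measurable_fun (phase_space R) H by exact: measurable_funTS.
apply: (@lt_le_trans _ _ (\int[dV R]_(s in phase_space R) expR (- (`|x| * M)))).
  rewrite Rintegral_cst// mulr_gt0 ?expR_gt0//.
  have := p0; rewrite exp_moment0E; under eq_Rintegral do rewrite expr0.
  by rewrite Rintegral_cst// mul1r => ->; rewrite mulr_gt0// exprn_gt0// pi_gt0.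
apply: le_Rintegral => //.
- exact: (bounded_measurable_integrable mP fP (bounded_measurable_cst _ _)).
- exact: (integrable_exp_moment mP fP mHP HM).
move=> s Ps; rewrite expr0 mul1r ler_expR lerNl.
apply: (le_trans (ler_norm _)); rewrite normrN normrM ler_wpM2l//; exact: HM.
Qed.

Lemma is_derive_mean_energy x :
  is_derive (x : R) (1 : R) (fun x => Phi 1 x / Phi 0 x) (energy_variance x).
Proof.
have h0 := is_derive_phase_moment 0 x; have h1 := is_derive_phase_moment 1 x.
have p0 : Phi 0 x != 0 by rewrite gt_eqF// phase_partition_gt0.
have hV : is_derive (x : R) (1 : R) (fun x => (Phi 0 x)^-1) (- (Phi 0 x) ^- 2 *: Phi 1 x).
  exact: is_deriveV.
apply: (is_derive_eq (is_derive_fM h1 hV)).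
by rewrite /energy_variance /GRing.scale/=; field.
Qed.

(** Write g = [gap 0]. As [Phi 0] is C g / x, its second logarithmic derivative is (log g)'' + 1 /
    x^2. By [gap_ode], g' / g = 1 + b / 4 - 1 / (2 x) + rho, so (log g)'' = 1 / (2 x^2) + rho', and
    rho' = rho1 - rho (1 / x + g' / g). The two powers of 1 / x add up to 3/2. *)
Lemma sqr_energy_variance x : x != 0 ->
  let rho := boundary x / (2 * x * gap 0 x) in
  let rho1 := boundary' x / (2 * x * gap 0 x) in
  x ^+ 2 * energy_variance x =
  3 / 2 + x ^+ 2 * (rho1 - rho * (1 + b / 4 + (2 * x)^-1 + rho)).
Proof.
move=> x0 rho rho1.
have C0 : C != 0 by rewrite gt_eqF// interval_const_gt0.
have p0 : Phi 0 x != 0 by rewrite gt_eqF// phase_partition_gt0.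
have e0 y : y * Phi 0 y = C * gap 0 y by exact: partition_interval.
have e1 y : Phi 0 y + y * Phi 1 y = C * gap 1 y.
  have h0 := is_derive_phase_moment 0 y; have h1 := is_derive_gap 0 y.
  apply: (@is_derive_unique _ (fun y => y * Phi 0 y) y).
    by apply: is_derive_eq; rewrite /GRing.scale/=; ring.
  rewrite (_ : (fun y => y * Phi 0 y) = fun y => C * gap 0 y); last exact/funext.
  by apply: is_derive_eq; rewrite /GRing.scale/=; ring.
have e2 y : 2 * Phi 1 y + y * Phi 2 y = C * gap 2 y.
  have h0 := is_derive_phase_moment 0 y; have h1 := is_derive_phase_moment 1 y; have h2 := is_derive_gap 1 y.
  apply: (@is_derive_unique _ (fun y => Phi 0 y + y * Phi 1 y) y).
    by apply: is_derive_eq; rewrite /GRing.scale/=; ring.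
  rewrite (_ : (fun y => Phi 0 y + y * Phi 1 y) = fun y => C * gap 1 y); last exact/funext.
  by apply: is_derive_eq; rewrite /GRing.scale/=; ring.
have g0 : gap 0 x != 0.
  by apply: contra p0 => /eqP g0; have := e0 x; rewrite g0 mulr0 => /eqP; rewrite mulf_eq0 (negbTE x0).
have p0E : Phi 0 x = C * gap 0 x / x by rewrite -e0; field.
have p1E : Phi 1 x = (C * gap 1 x - Phi 0 x) / x by rewrite -e1; field.
have p2E : Phi 2 x = (C * gap 2 x - 2 * Phi 1 x) / x by rewrite -e2; field.
rewrite /energy_variance p2E p1E p0E /rho /rho1 gap_ode gap_ode'.
move: (gap 0 x) g0 (gap 1 x) (gap 2 x) => G0 g0 G1 G2; move: b C C0 => B c c0.
by field; rewrite ?x0 ?g0 ?c0.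
Qed.

End specific_heat_formula.

(** * Bounds for integrals by explicit primitives and by subintervals *)

Section integral_bounds.
Context {R : realType}.
Local Notation mu := (@lebesgue_measure R).

Lemma Rintegral_itv_ge (f F dF : R -> R) (a b : R) : a < b ->
  {in `[a, b], continuous f} -> {in `[a, b], continuous dF} ->
  (forall x, x \in `[a, b] -> is_derive (x : R) (1 : R) F (dF x)) ->
  (forall x, x \in `[a, b] -> dF x <= f x) ->
  F b - F a <= \int[mu]_(x in `[a, b]) f x.
Proof.
move=> ab cf cdF hF le; rewrite -(Rintegral_FTC2_itv ab cdF hF).
apply: le_Rintegral => //.
- apply: continuous_compact_integrable; first exact: segment_compact.
  by apply: continuous_in_subspaceT => x; rewrite inE; exact: cdF.
- apply: continuous_compact_integrable; first exact: segment_compact.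
  by apply: continuous_in_subspaceT => x; rewrite inE; exact: cf.
Qed.

Lemma Rintegral_itv_le (f F dF : R -> R) (a b : R) : a < b ->
  {in `[a, b], continuous f} -> {in `[a, b], continuous dF} ->
  (forall x, x \in `[a, b] -> is_derive (x : R) (1 : R) F (dF x)) ->
  (forall x, x \in `[a, b] -> f x <= dF x) ->
  \int[mu]_(x in `[a, b]) f x <= F b - F a.
Proof.
move=> ab cf cdF hF le; rewrite -(Rintegral_FTC2_itv ab cdF hF).
apply: le_Rintegral => //.
- apply: continuous_compact_integrable; first exact: segment_compact.
  by apply: continuous_in_subspaceT => x; rewrite inE; exact: cf.
- apply: continuous_compact_integrable; first exact: segment_compact.
  by apply: continuous_in_subspaceT => x; rewrite inE; exact: cdF.
Qed.

Lemma Rintegral_itv_ge_sub (f : R -> R) (a b a' b' c : R) : a < b -> a <= a' ->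
  a' < b' -> b' <= b -> continuous f -> (forall x, x \in `[a, b] -> 0 <= f x) ->
  (forall x, x \in `[a', b'] -> c <= f x) ->
  c * (b' - a') <= \int[mu]_(x in `[a, b]) f x.
Proof.
move=> ab aa ab' bb cf f0 fc.
have dc (x : R) : is_derive (x : R) (1 : R) (fun x => c * x) c.
  by apply: is_derive_eq; rewrite /GRing.scale/=; ring.
have sub : `[a', b'] `<=` `[a, b].
  by apply: subset_itv; rewrite leBSide.
apply: (@le_trans _ _ (\int[mu]_(x in `[a', b']) f x)).
  rewrite mulrBr; apply: (@Rintegral_itv_ge f (fun x => c * x) (fun=> c)).
  - exact: ab'.
  - by move=> x _; exact: cf.
  - by move=> x _; exact: cvg_cst.
  - exact: fc.
have i1 := continuous_itv_integrable a b cf.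
have i2 := continuous_itv_integrable a' b' cf.
rewrite /Rintegral fine_le//; first exact: integrable_fin_num i2.
  exact: integrable_fin_num i1.
apply: ge0_subset_integral => //.
  by move/integrableP : i1 => [].
Qed.

End integral_bounds.

(** * The limit x -> +oo: an interior maximum dominates *)

Section low_temperature_cstar.
Context {R : realType}.
Local Notation mu := (@lebesgue_measure R).
Local Notation r2 := (Num.sqrt 2 : R).
Local Notation a := (@wmin R).
Local Notation b := (@wmax R).
Local Notation k := (@kappa R).
Local Notation W := `[a, b]%classic.

Lemma gap0E x : gap 0 x =
  \int[mu]_(w in W) (expR (x * energy_max w) - expR (x * energy_min w)).
Proof.
rewrite /gap /exp_moment -RintegralB//; last 2 first.
- exact: integrable_energy_max.
- exact: integrable_energy_min.
by apply: eq_Rintegral => w _; rewrite !expr0 !mul1r.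
Qed.

Lemma continuous_exp_energy_max (x : R) : continuous (fun w : R => expR (x * energy_max w)).
Proof.
move=> w; apply: (@continuous_comp _ _ _ (fun w => x * energy_max w) expR).
  by apply: cvgM; [exact: cvg_cst|exact: continuous_energy_max].
exact: continuous_expR.
Qed.

Lemma continuous_exp_energy_min (x : R) : continuous (fun w : R => expR (x * energy_min w)).
Proof.
move=> w; apply: (@continuous_comp _ _ _ (fun w => x * energy_min w) expR).
  by apply: cvgM; [exact: cvg_cst|exact: continuous_energy_min].
exact: continuous_expR.
Qed.

(* The maximum 1 + b / 4 of energy_max is attained at b / 2, inside W; on [b / 2, b / 2 + 1 / 10] the energy
   still exceeds the values at the endpoints of W. *)
Local Notation peak := (1 + b / 4 - k / 100).

(** On W the energies differ by 2 w >= r2, so for x >= 1 subtracting the second exponential costs at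
    most half of the first. The factor 1/20 is this half times the length 1/10 of the interval next
    to the vertex. *)
Lemma gap_ge x : 1 <= x -> 1 / 20 * expR (peak * x) <= gap 0 x.
Proof.
move=> x1; have s1 := @sqrt2_gt R; have s2 := @sqrt2_lt R; have kb := @kappa_wmax R.
have diff w : w \in `[a, b] ->
    1 / 2 * expR (x * energy_max w) <= expR (x * energy_max w) - expR (x * energy_min w).
  rewrite in_itv/= => /andP[aw wb].
  rewrite (_ : x * energy_min w = x * energy_max w - 2 * w * x); last first.
    by rewrite /energy_min /energy_max; ring.
  rewrite expRB; have h : 2 <= expR (2 * w * x).
    apply: le_trans (expR_ge1Dx _); move: aw; rewrite /wmin => aw; nra.
  have e0 : 0 < expR (x * energy_max w) by exact: expR_gt0.
  rewrite lerBrDl -lerBrDr (_ : _ - _ = expR (x * energy_max w) * 2^-1); last by field.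
  by rewrite ler_pM2l// lef_pV2 ?posrE ?expR_gt0.
rewrite gap0E.
have := @Rintegral_itv_ge_sub _
  (fun w => expR (x * energy_max w) - expR (x * energy_min w)) a b (b / 2) (b / 2 + 1 / 10)
  (1 / 2 * expR (peak * x)).
rewrite (_ : _ * (_ - _) = 1 / 20 * expR (peak * x)); last by field.
apply.
- exact: wmin_lt_wmax.
- by rewrite /wmin /wmax; lra.
- by lra.
- by rewrite /wmax; lra.
- by move=> w; apply: cvgB; [exact: continuous_exp_energy_max|exact: continuous_exp_energy_min].
- move=> w /diff; apply: le_trans; rewrite mulr_ge0// expR_ge0.
move=> w wi; have wab : w \in `[a, b].
  by move: wi; rewrite !in_itv/= /wmin /wmax => /andP[? ?]; apply/andP; split; lra.
apply: le_trans (diff w wab); rewrite ler_pM2l// ler_expR mulrC.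
rewrite ler_pM2l; last exact: lt_le_trans x1.
move: wi; rewrite in_itv/= => /andP[w1 w2].
(* Completing the square at b / 2; the second summand vanishes by [kappa_wmax]. *)
rewrite -subr_ge0 (_ : _ - _ = k * (1 / 100 - (w - b / 2) ^+ 2) + (k * b - 1) * (b / 4 - w)); last first.
  by rewrite /energy_max; field.
rewrite kb subrr mul0r addr0 mulr_ge0//; first by rewrite /kappa; lra.
rewrite subr_ge0 expr2; nra.
Qed.

(** The largest exponent in [boundary] and [boundary'] is r2, the energy at the left endpoint, and
    it lies below [peak]. *)
Lemma decays_expR_gap n c : c <= r2 -> decays n (fun x => expR (c * x) / gap 0 x).
Proof.
move=> cr; have s1 := @sqrt2_gt R; have s2 := @sqrt2_lt R.
(* At c = r2 this reads 1.23 > 0.865 r2, a thin margin for which r2 < 17/12 is sharp enough. *)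
have e0 : 0 < peak - c by rewrite /wmax /kappa; lra.
apply: (decays_le _ (decaysZ 20 (decays_expR n e0))); near=> x.
have x1 : 1 <= x by near: x; exact: nbhs_pinfty_ge.
have g1 := gap_ge x1; have e1 := expR_gt0 (peak * x).
have g0 : 0 < gap 0 x by apply: lt_le_trans g1; rewrite mulr_gt0.
have n20 : (0 : R) <= 20 by [].
rewrite (ger0_norm (divr_ge0 (expR_ge0 _) (ltW g0))).
rewrite (ger0_norm (mulr_ge0 n20 (expR_ge0 _))) ler_pdivrMr//.
have -> : expR (c * x) = expR (- ((peak - c) * x)) * expR (peak * x).
  by rewrite -expRD; congr expR; ring.
rewrite (_ : expR _ * _ = 20 * expR (- ((peak - c) * x)) * (1 / 20 * expR (peak * x))).
  by rewrite ler_wpM2l// mulr_ge0// expR_ge0.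
by field.
Unshelve. all: by end_near. Qed.

Lemma decays_boundary_gap n : decays n (fun x : R => boundary x / gap 0 x).
Proof.
have s1 := @sqrt2_gt R.
have h1 := decays_expR_gap n (c := 1); have h2 := decays_expR_gap n (lexx r2).
have h3 := decays_expR_gap n (c := - (1 + r2)); have h4 := decays_expR_gap n (c := 0).
have {}h1 := h1 ltac:(lra); have {}h3 := h3 ltac:(lra); have {}h4 := h4 ltac:(lra).
apply: decays_near (decaysD (decaysB (decaysB (decaysZ (b / 2) h1)
  (decaysZ (a - b / 2) h2)) (decaysZ (3 * b / 2) h3)) (decaysZ (a + b / 2) h4)).
apply: nearW => x; rewrite /boundary mul1r mul0r expR0 mulNr; ring.
Qed.

Lemma decays_boundary'_gap n : decays n (fun x : R => boundary' x / gap 0 x).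
Proof.
have s1 := @sqrt2_gt R.
have h1 := decays_expR_gap n (c := 1); have h2 := decays_expR_gap n (lexx r2).
have h3 := decays_expR_gap n (c := - (1 + r2)).
have {}h1 := h1 ltac:(lra); have {}h3 := h3 ltac:(lra).
apply: decays_near (decaysD (decaysB (decaysZ (b / 2) h1)
  (decaysZ (r2 * (a - b / 2)) h2)) (decaysZ ((1 + r2) * (3 * b / 2)) h3)).
apply: nearW => x; rewrite /boundary' mul1r mulNr; ring.
Qed.

Lemma decays_half_inv : decays 1 (fun x : R => (2 * x)^-1).
Proof.
apply: decays_near (decaysZ 2^-1 (@decaysV R)); apply: nearW => x.
by rewrite invfM.
Qed.

(** Both [rho] and [rho1] decay to every order, so the factor x^2 is harmless and only 3/2
    survives. *)
Lemma sqr_energy_variance_pinfty :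
  decays 1 (fun x : R => x ^+ 2 * energy_variance x - 3 / 2).
Proof.
pose rho (x : R) := boundary x / (2 * x * gap 0 x).
pose rho1 (x : R) := boundary' x / (2 * x * gap 0 x).
have hrho n : decays n rho.
  apply: (@decaysW _ n n.+1) => //.
  apply: decays_near (decaysM decays_half_inv (decays_boundary_gap n)).
  by apply: nearW => x; rewrite /rho [in RHS]invfM mulrCA mulrA.
have hrho1 n : decays n rho1.
  apply: (@decaysW _ n n.+1) => //.
  apply: decays_near (decaysM decays_half_inv (decays_boundary'_gap n)).
  by apply: nearW => x; rewrite /rho1 [in RHS]invfM mulrCA mulrA.
have hin : decays 0 (fun x : R => 1 + b / 4 + (2 * x)^-1 + rho x).
  apply: decaysD; last exact: hrho.
  apply: decaysD; first exact: decays_cst.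
  exact: (decaysW _ decays_half_inv).
have h3 : decays 3 (fun x : R => rho1 x - rho x * (1 + b / 4 + (2 * x)^-1 + rho x)).
  by apply: decaysB; [exact: hrho1|exact: (decaysM (hrho 3) hin)].
apply: decays_near (@decays_exprM _ 2 1 _ h3); near=> x.
have x0 : x != 0 by rewrite gt_eqF//; near: x; exact: nbhs_pinfty_gt.
by rewrite sqr_energy_variance//= [RHS]addrC addKr.
Unshelve. all: by end_near. Qed.

End low_temperature_cstar.

(** * The limit x -> -oo: expansion of the integral at an endpoint *)

Section low_temperature_c.
Context {R : realType}.
Local Notation mu := (@lebesgue_measure R).
Local Notation r2 := (Num.sqrt 2 : R).
Local Notation a := (@wmin R).
Local Notation b := (@wmax R).
Local Notation z := (2 * @kappa R).
Local Notation W := `[a, b]%classic.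

Definition dominant_part (x : R) : R := \int[mu]_(w in W) expR (x * - energy_min w).
Definition minor_part (x : R) : R := \int[mu]_(w in W) expR (- x * energy_max w).

Lemma gapN x : gap 0 (- x) = minor_part x - dominant_part x.
Proof.
rewrite gap0E RintegralB//; last 2 first.
- by apply: continuous_itv_integrable; exact: continuous_exp_energy_max.
- by apply: continuous_itv_integrable; exact: continuous_exp_energy_min.
by congr (_ - _); apply: eq_Rintegral => w _; rewrite mulNr mulrN.
Qed.

(** On W, kappa w^2 <= w because kappa [wmax] = 1, so [energy_max] is nonnegative there; and W has
    length 1. *)
Lemma minor_part_bound x : 0 <= x -> 0 <= minor_part x <= 1.
Proof.
move=> x0; have s1 := @sqrt2_gt R; have s2 := @sqrt2_lt R; apply/andP; split.
  by apply: Rintegral_ge0 => w _; exact: expR_ge0.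
have ba : (b : R) - a = 1 by rewrite /wmin /wmax; ring.
have dF (w : R) : w \in `[a, b] -> is_derive (w : R) (1 : R) (fun w : R => w) 1.
  by move=> _; exact: is_derive_id.
rewrite -ba; apply: (Rintegral_itv_le (@wmin_lt_wmax R) _ _ dF).
- by move=> w _; exact: continuous_exp_energy_max.
- by move=> w _; exact: cvg_cst.
move=> w; rewrite in_itv/= => /andP[aw wb].
rewrite -[leRHS]expR0 ler_expR mulNr oppr_le0 mulr_ge0//.
have kb := @kappa_wmax R; have k0 : 0 < @kappa R by rewrite /kappa; lra.
have w0 : 0 <= w by apply: le_trans aw; rewrite /wmin; lra.
rewrite /energy_max expr2.
have : @kappa R * w * w <= 1 * w.
  by rewrite ler_wpM2r// -kb ler_pM2l.
rewrite -mulrA; lra.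
Qed.

Local Notation p := (fun w : R => (z * w + 1)^-1).

(* With q = - energy_min one has q' = 1 / p, and these are the first five terms of the expansion obtained by
   integrating exp (x q) = (exp (x q))' p / x repeatedly by parts. *)
Definition expansion (x t : R) : R := x^-1 * t + z * x ^- 2 * t ^+ 3
  + 3 * z ^+ 2 * x ^- 3 * t ^+ 5 + 15 * z ^+ 3 * x ^- 4 * t ^+ 7
  + 105 * z ^+ 4 * x ^- 5 * t ^+ 9.

Definition expansion_primitive (x w : R) : R :=
  expR (x * - energy_min w) * expansion x (p w).

(** Write q = - [energy_min]. The derivative of [expansion_primitive] is exp(x q) (1 - 945 z^5 x^-5
    p^10), which is at most exp(x q); this gives the lower bound. *)
Lemma dominant_part_expansion x : 0 < x ->
  expansion_primitive x b - expansion_primitive x a <= dominant_part x <=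
  expansion_primitive x b - expansion_primitive x a
    + 945 * z ^+ 5 * x ^- 6 * expR (x * - energy_min (b : R)).
Proof.
move=> x0; pose F := expansion_primitive x; rewrite -!/(F _).
have s1 := @sqrt2_gt R; have s2 := @sqrt2_lt R.
have z0 : 0 < z by rewrite /kappa; lra.
have pos w : w \in `[a, b] -> 1 <= z * w + 1.
  rewrite in_itv/= => /andP[aw _]; rewrite lerDr mulr_ge0 ?(ltW z0)//.
  by apply: le_trans aw; rewrite /wmin; lra.
have posn w : w \in `[a, b] -> z * w + 1 != 0.
  by move=> /pos h; rewrite gt_eqF// (lt_le_trans _ h).
have dq w : is_derive (w : R) (1 : R) (fun w => - energy_min w) (z * w + 1).
  by rewrite /energy_min; apply: is_derive_eq; rewrite /GRing.scale/=; ring.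
have de w : is_derive (w : R) (1 : R) (fun w => expR (x * - energy_min w))
    (x * (z * w + 1) * expR (x * - energy_min w)).
  have h := dq w; apply: is_derive_eq; rewrite /GRing.scale/=; ring.
have dl w : is_derive (w : R) (1 : R) (fun w => z * w + 1) z.
  by apply: is_derive_eq; rewrite /GRing.scale/=; ring.
have dp w : w \in `[a, b] -> is_derive (w : R) (1 : R) p (- z * p w ^+ 2).
  move=> wi; have hV : is_derive (w : R) (1 : R) p (- (z * w + 1) ^- 2 *: z).
    by have hn := posn w wi; have hd := dl w; exact: is_deriveV.
  by apply: (is_derive_eq hV); rewrite /GRing.scale/=; field; exact: posn.
have dE w : w \in `[a, b] -> is_derive (w : R) (1 : R) (fun w => expansion x (p w))
    (- z * p w ^+ 2 * (x^-1 + 3 * z * x ^- 2 * p w ^+ 2 + 15 * z ^+ 2 * x ^- 3 * p w ^+ 4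
     + 105 * z ^+ 3 * x ^- 4 * p w ^+ 6 + 945 * z ^+ 4 * x ^- 5 * p w ^+ 8)).
  move=> wi; have hp := dp w wi; rewrite /expansion.
  have hX n := is_derive_fX n hp.
  have hM n c := is_derive_fM (is_derive_cst c w 1) (hX n).
  apply: (is_derive_eq (is_deriveD (is_deriveD (is_deriveD (is_deriveD
    (is_derive_fM (is_derive_cst x^-1 w 1) hp)
    (hM 3%N (z * x ^- 2))) (hM 5%N (3 * z ^+ 2 * x ^- 3)))
    (hM 7%N (15 * z ^+ 3 * x ^- 4))) (hM 9%N (105 * z ^+ 4 * x ^- 5)))).
  rewrite /cst/=; move: (p w) => t; ring.
pose f w := expR (x * - energy_min w) * (1 - 945 * z ^+ 5 * x ^- 5 * p w ^+ 10).
have dF w : w \in `[a, b] -> is_derive (w : R) (1 : R) F (f w).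
  move=> wi; apply: (is_derive_eq (is_derive_fM (de w) (dE w wi))).
  rewrite /f /expansion; move: (expR _) => E.
  have tE : z * w + 1 = (p w)^-1 by rewrite invrK.
  rewrite tE; have : p w != 0 by rewrite invr_eq0 posn.
  have : x != 0 by rewrite gt_eqF.
  move: (p w) => t x0' t0; field; by rewrite ?x0' ?t0.
have ce : continuous (fun w : R => expR (x * - energy_min w)).
  by move=> w; exact: is_derive_continuous (de w).
have cp10 w : w \in `[a, b] -> {for w, continuous (fun w => p w ^+ 10)}.
  by move=> wi; exact: is_derive_continuous (is_derive_fX 10 (dp w wi)).
have cf : {in `[a, b], continuous f}.
  move=> w wi; apply: cvgM; first exact: ce.
  apply: cvgB; first exact: cvg_cst.
  by apply: cvgM; [exact: cvg_cst|exact: cp10].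
have cn n : 0 <= 945 * z ^+ 5 * x ^- n.
  apply: mulr_ge0; last by rewrite invr_ge0; exact: exprn_ge0 (ltW x0).
  by apply: mulr_ge0; [exact: ler0n|exact: exprn_ge0 (ltW z0)].
have p10 w : w \in `[a, b] -> 0 <= p w ^+ 10 <= 1.
  move=> /pos h; have pw : 0 <= p w by rewrite invr_ge0 (le_trans _ h).
  by rewrite exprn_ge0//= exprn_ile1// invf_le1// (lt_le_trans _ h).
apply/andP; split.
  apply: (Rintegral_itv_ge (@wmin_lt_wmax R) _ cf dF).
    by move=> w _; exact: ce.
  move=> w /p10 /andP[h _]; rewrite /f; apply: ler_piMr; first exact: expR_ge0.
  by rewrite gerBl; exact: mulr_ge0 (cn _) h.
(* The added term has derivative 945 z^5 x^-5 q' exp(x q) with q' >= 1 >= p^10, which outweighs the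
   deficit; its value at the left endpoint is dropped afterwards. *)
pose G w := F w + 945 * z ^+ 5 * x ^- 6 * expR (x * - energy_min w).
pose g w := f w + 945 * z ^+ 5 * x ^- 6 * (x * (z * w + 1) * expR (x * - energy_min w)).
have dG w : w \in `[a, b] -> is_derive (w : R) (1 : R) G (g w).
  move=> wi; apply: (is_derive_eq (is_deriveD (dF w wi)
    (is_derive_fM (is_derive_cst (945 * z ^+ 5 * x ^- 6) w 1) (de w)))).
  by rewrite /cst/= mul0r add0r.
have cg : {in `[a, b], continuous g}.
  move=> w wi; apply: cvgD; first exact: cf.
  apply: cvgM; first exact: cvg_cst.
  apply: cvgM; last exact: ce.
  by apply: cvgM; [exact: cvg_cst|exact: is_derive_continuous (dl w)].
apply: (@le_trans _ _ (G b - G a)).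
  apply: (Rintegral_itv_le (@wmin_lt_wmax R) _ cg dG).
    by move=> w _; exact: ce.
  move=> w wi; have /andP[_ h1] := p10 w wi; have h2 := pos w wi.
  rewrite /g /f; have := expR_gt0 (x * - energy_min w); move: (expR _) => E E0.
  rewrite (_ : _ + _ = E * (1 + 945 * z ^+ 5 * x ^- 5 * ((z * w + 1) - p w ^+ 10))); last first.
    have xn0 : x != 0 by rewrite gt_eqF.
    by move: (posn w wi); move: (z * w + 1) => u u0; field; rewrite u0 xn0.
  apply: ler_peMr; first exact: ltW.
  rewrite lerDl; apply: mulr_ge0; first exact: cn.
  by rewrite subr_ge0; exact: le_trans h1 h2.
have h := mulr_ge0 (cn 6%N) (expR_ge0 (x * - energy_min (a : R))).
rewrite -subr_ge0 [leRHS](_ : _ = 945 * z ^+ 5 * x ^- 6 * expR (x * - energy_min (a : R)))//.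
by rewrite /G; ring.
Qed.

End low_temperature_c.

(** * Low-temperature expansion of the variance up to second order *)

Section low_temperature_expansion.
Context {R : realType}.
Local Notation r2 := (Num.sqrt 2 : R).
Local Notation a := (@wmin R).
Local Notation b := (@wmax R).
Local Notation z := (2 * @kappa R).
Local Notation v := (fun x : R => z / 9 * x^-1).
Local Notation E := (fun x : R => expR (- ((1 + r2) * x))).

Let r2_gt0 : 0 < 1 + r2. Proof. by have := @sqrt2_gt R; lra. Qed.
Let z_gt0 : 0 < z. Proof. by have := @sqrt2_lt R; rewrite /kappa; lra. Qed.
Let zb : z * b = 2. Proof. by have := @kappa_wmax R; lra. Qed.

(** The truncated error-function series with coefficients (2n-1)!!. At w = b one has p = 1/3, since
    z b = 2, and the variable is t = z p^2 / x = z / (9 x). *)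
Definition leading (t : R) : R := 1 + t + 3 * t ^+ 2 + 15 * t ^+ 3 + 105 * t ^+ 4.

(** This is [- gap 0 (- x)], normalized by its leading behaviour so as to tend to 1. *)
Definition scaled_gap (x : R) : R := 3 * x * E x * (dominant_part x - minor_part x).

Let decays_v : decays 1 v. Proof. exact: (decaysZ (z / 9) (@decaysV R)). Qed.
Let decays0_v : decays 0 v. Proof. exact: (decaysW (leq0n 1) decays_v). Qed.
Let decays0_inv : decays 0 (fun x : R => x^-1).
Proof. exact: (decaysW (leq0n 1) (@decaysV R)). Qed.
Let decays_E n : decays n E. Proof. exact: decays_expR. Qed.

Ltac d0 := repeat first [exact: decays_cst | exact: decays0_v | exact: decays0_inv
  | apply: decaysD | apply: decaysN | apply: decays0X | apply: (@decaysM R 0 0)].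

(** The left endpoint and [minor_part] are exponentially small after multiplication by E; the
    remainder with 945 becomes a multiple of x^-5. The function g below collects these bounds. *)
Lemma scaled_gap_expansion :
  decays 5 (fun x : R => scaled_gap x - leading (z / 9 * x^-1)).
Proof.
pose t0 : R := (z * a + 1)^-1.
have hF : decays 0 (fun x : R => `|expansion x t0|).
  apply: decays_norm; rewrite /expansion.
  apply: (decays_near (f := fun x => x^-1 * t0 + z * x^-1 ^+ 2 * t0 ^+ 3
    + 3 * z ^+ 2 * x^-1 ^+ 3 * t0 ^+ 5 + 15 * z ^+ 3 * x^-1 ^+ 4 * t0 ^+ 7
    + 105 * z ^+ 4 * x^-1 ^+ 5 * t0 ^+ 9)).
    by apply: nearW => x; rewrite !exprVn.
  by d0.
pose g (x : R) := 3 * (x ^+ 1 * (E x * (`|expansion x t0| + 1))) +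
  3 * (945 * z ^+ 5) * x^-1 ^+ 5.
have hg : decays 5 g.
  apply: decaysD.
    apply: decaysZ; apply: (@decays_exprM _ 1 5).
    apply: (@decaysM _ 6 0); first exact: decays_E.
    by apply: decaysD => //; exact: decays_cst.
  by apply: decaysZ; apply: decaysX; exact: decaysV.
apply: decays_le hg; near=> x.
have x0 : 0 < x by near: x; exact: nbhs_pinfty_gt.
have xn0 : x != 0 by rewrite gt_eqF.
have /andP[l1 l2] := dominant_part_expansion x0.
have /andP[m1 m2] := minor_part_bound (ltW x0).
have e0 : 0 < E x by exact: expR_gt0.
have en0 : E x != 0 by rewrite gt_eqF.
have qb : expR (x * - energy_min (b : R)) = (E x)^-1.
  by rewrite energy_min_wmax opprK -expRN opprK mulrC.
have Fa : expansion_primitive x a = expansion x t0.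
  by rewrite /expansion_primitive energy_min_wmin oppr0 mulr0 expR0 mul1r.
have Fb : 3 * x * E x * expansion_primitive x b = leading (z / 9 * x^-1).
  rewrite /expansion_primitive qb zb (_ : (2 + 1)^-1 = 3^-1 :> R); last by congr _^-1; ring.
  rewrite /leading /expansion; move: (E x) en0 => Ex Ex0.
  by field; rewrite ?xn0 ?Ex0.
have lead : scaled_gap x - leading (z / 9 * x^-1) =
    3 * x * E x * (dominant_part x - expansion_primitive x b - minor_part x).
  by rewrite -Fb /scaled_gap; ring.
have c0 : 0 <= 945 * z ^+ 5 * x ^- 6.
  apply: mulr_ge0; last by rewrite invr_ge0; exact: exprn_ge0 (ltW x0).
  by apply: mulr_ge0; [exact: ler0n|exact: exprn_ge0 (ltW z_gt0)].
rewrite qb Fa in l1 l2.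
have k0 : 0 <= 3 * x * E x by rewrite !mulr_ge0 ?expR_ge0 ?ltW.
have gE : g x = 3 * x * E x * (`|expansion x t0| + 1 + 945 * z ^+ 5 * x ^- 6 * (E x)^-1).
  rewrite /g exprVn; move: (E x) en0 (945 * z ^+ 5) => Ex Ex0 c.
  by field; rewrite ?xn0 ?Ex0.
have ce0 := mulr_ge0 c0 (ltW (_ : 0 < (E x)^-1)).
have {}ce0 : 0 <= 945 * z ^+ 5 * x ^- 6 * (E x)^-1 by apply: ce0; rewrite invr_gt0.
rewrite lead normrM (ger0_norm k0); apply: (@le_trans _ _ (g x)); last exact: ler_norm.
rewrite gE ler_wpM2l//.
have n1 := ler_norm (expansion x t0); have n2 := ler_norm (- expansion x t0).
rewrite normrN in n2; move: l1 l2 n1 n2 ce0.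
move: (945 * _ * _ * _) (`|expansion x t0|) (expansion x t0) => c N1 F1 l1 l2 n1 n2 ce0.
rewrite ler_norml; apply/andP; split; lra.
Unshelve. all: by end_near. Qed.

(** The exponentially small corrections to [boundary (- x)] and [boundary' (- x)] once the term
    exp((1 + r2) x) is factored out. *)
Definition boundary_defect (x : R) : R := - (2 / (3 * b)) * (E x *
  (b / 2 * expR (- (1 * x)) - (a - b / 2) * expR (- (r2 * x)) + (a + b / 2))).
Definition boundary'_defect (x : R) : R := 2 / (3 * b) * (E x *
  (b / 2 * expR (- (1 * x)) - r2 * (a - b / 2) * expR (- (r2 * x)))).

Let b_gt0 : 0 < b. Proof. by have := @sqrt2_gt R; rewrite /wmax; lra. Qed.
Let sqrt2_gt0 : 0 < r2. Proof. by have := @sqrt2_gt R; lra. Qed.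

Lemma decays_boundary_defect n : decays n boundary_defect.
Proof.
apply: decaysZ; rewrite -[n]addn0; apply: decaysM; first exact: decays_E.
apply: decaysD; last exact: decays_cst.
apply: decaysB; apply: decaysZ; exact: decays_expR.
Qed.

Lemma decays_boundary'_defect n : decays n boundary'_defect.
Proof.
apply: decaysZ; rewrite -[n]addn0; apply: decaysM; first exact: decays_E.
apply: decaysB; apply: decaysZ; exact: decays_expR.
Qed.

Lemma boundaryN x : boundary (- x) = - (3 * b / 2) * (1 + boundary_defect x) / E x.
Proof.
have en0 : E x != 0 by rewrite gt_eqF// expR_gt0.
have bn0 : b != 0 by rewrite gt_eqF.
rewrite /boundary /boundary_defect !mulrN opprK mul1r.
rewrite (_ : expR ((1 + r2) * x) = (E x)^-1); last by rewrite -expRN opprK.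
move: (E x) en0 (expR (- x)) (expR (- (r2 * x))) => Ex Ex0 e1 e2.
by move: b bn0 => B B0; field; rewrite ?B0 ?Ex0.
Qed.

Lemma boundary'N x :
  boundary' (- x) = 3 * b / 2 * (1 + r2 + boundary'_defect x) / E x.
Proof.
have en0 : E x != 0 by rewrite gt_eqF// expR_gt0.
have bn0 : b != 0 by rewrite gt_eqF.
rewrite /boundary' /boundary'_defect !mulrN opprK mul1r.
rewrite (_ : expR ((1 + r2) * x) = (E x)^-1); last by rewrite -expRN opprK.
move: (E x) en0 (expR (- x)) (expR (- (r2 * x))) => Ex Ex0 e1 e2.
by move: b bn0 => B B0; field; rewrite ?B0 ?Ex0.
Qed.

(** The asserted value of x^2 times the variance, less the 3/2 of [sqr_energy_variance]. Up to the
    factor 81 x^2 / (4 z^2 X^2), with X = [scaled_gap x], [numerator] is the error of that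
    assertion. *)
Let tau (t : R) : R := 1 / 2 + 2 * t + 15 * t ^+ 2.
Let defect (x : R) : R := 2 * z / 9 * (boundary'_defect x +
  boundary_defect x * (1 + b / 4 - x^-1 / 2)).
Let numerator (x : R) : R := scaled_gap x * (1 - v x + defect x)
  - (1 + boundary_defect x) ^+ 2 - 4 * v x ^+ 2 * tau (v x) * scaled_gap x ^+ 2.

Let near_scaled_gap : \forall x \near +oo, 1 / 4 <= `|scaled_gap x ^+ 2|.
Proof.
have h : decays 1 (fun x => scaled_gap x - 1).
  apply: (decays_near (f := fun x => (scaled_gap x - leading (z / 9 * x^-1)) +
     v x * (1 + 3 * v x + 15 * v x ^+ 2 + 105 * v x ^+ 3))).
    by apply: nearW => x; rewrite /leading; ring.
  apply: decaysD; first exact: (decaysW _ scaled_gap_expansion).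
  by apply: (@decaysM _ 1 0) => //; d0.
have h2 : (0 : R) < 1 / 2 by lra.
near=> x; have : `|scaled_gap x - 1| <= 1 / 2 by near: x; exact: decays1_small.
rewrite ler_norml => /andP[h1 _].
rewrite ger0_norm ?sqr_ge0// expr2; nra.
Unshelve. all: by end_near. Qed.

(** With X replaced by [leading (v x)], the terms without defects are (1 - v) leading(v) - 1 - 4 v^2
    tau(v) leading(v)^2. Both (1 - v) leading(v) - 1 and 4 v^2 tau(v) leading(v)^2 begin with 2 v^2
    + 12 v^3 + 90 v^4, which forces the coefficients of [tau]; what is left is divisible by v^5. *)
Let decays_numerator : decays 5 numerator.
Proof.
have hd := scaled_gap_expansion.
have hd0 : decays 0 (fun x : R => scaled_gap x - leading (z / 9 * x^-1)).
  exact: decaysW hd.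
have he n := decays_boundary_defect n; have he' n := decays_boundary'_defect n.
have hdef : decays 5 defect.
  apply: decaysZ; apply: decaysD => //; apply: (@decaysM _ 5 0) => //.
  by d0.
have hX : decays 0 scaled_gap.
  apply: (decays_near (f := fun x => (scaled_gap x - leading (z / 9 * x^-1)) + leading (v x))).
    by apply: nearW => x; rewrite subrK.
  by apply: decaysD => //; rewrite /leading; d0.
pose d x := scaled_gap x - leading (z / 9 * x^-1).
(* The tail of the square: leading(t)^2 = 1 + 2 t + 7 t^2 + t^3 t2(t). *)
pose t2 (t : R) := 36 + 249 * t + 300 * t ^+ 2 + 855 * t ^+ 3 + 30 * 105 * t ^+ 4 + 105 * 105 * t ^+ 5.
apply: (decays_near (f := fun x =>
  v x ^+ 5 * (- 105 - 4 * (44 + 105 * v x) - 4 * (tau (v x) * t2 (v x)))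
  + d x * (1 - v x) + defect x * scaled_gap x - 2 * boundary_defect x
  - boundary_defect x * boundary_defect x
  - d x * (4 * v x ^+ 2 * tau (v x) * (2 * leading (v x) + d x)))).
  apply: nearW => x; rewrite /numerator.
  rewrite (_ : scaled_gap x = leading (v x) + d x); last by rewrite /d addrC subrK.
  by rewrite /tau /t2 /leading; move: (v x) (d x) (defect x) (boundary_defect x) => V D1 e h; field.
apply: decaysB; first apply: decaysB; first apply: decaysB; first apply: decaysD;
  first apply: decaysD.
- apply: (@decaysM _ 5 0); first exact: decaysX.
  by rewrite /tau /t2; d0.
- by apply: (@decaysM _ 5 0) => //; d0.
- exact: (@decaysM _ 5 0).
- exact: decaysZ.
- exact: (@decaysM _ 5 0).
apply: (@decaysM _ 5 0) => //; apply: (@decaysM _ 0 0); first by rewrite /tau; d0.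
by apply: decaysD => //; rewrite /leading; d0.
Qed.

Lemma sqr_energy_variance_ninfty : decays 3 (fun x : R =>
  x ^+ 2 * energy_variance (- x) - (2 + 2 * v x + 15 * v x ^+ 2)).
Proof.
have c4 : (0 : R) < 1 / 4 by lra.
have h := decays_div c4 near_scaled_gap decays_numerator.
apply: decays_near (@decays_exprM _ 2 3 _ (decaysZ (81 / (4 * z ^+ 2)) h)); near=> x.
have x0 : x != 0 by rewrite gt_eqF//; near: x; exact: nbhs_pinfty_gt.
have X0 : scaled_gap x != 0.
  have : 1 / 4 <= `|scaled_gap x ^+ 2| by near: x; exact: near_scaled_gap.
  by apply: contraTneq => ->; rewrite expr0n/= normr0 -ltNge.
have nx0 : - x != 0 by rewrite oppr_eq0.
have en0 : E x != 0 by rewrite gt_eqF// expR_gt0.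
have zn0 : z != 0 by rewrite gt_eqF.
rewrite -[x ^+ 2 * energy_variance _]/(x ^+ 2 * _) -(sqrrN x) sqr_energy_variance//=.
rewrite (_ : gap 0 (- x) = - (scaled_gap x / (3 * x * E x))); last first.
  rewrite gapN /scaled_gap; move: (E x) en0 => Ex Ex0.
  by field; rewrite ?x0 ?Ex0.
rewrite boundaryN boundary'N /numerator /tau /defect.
(* Expressing b and r2 rationally in z encodes the algebraic relation of the square root, so that
   [field] can close the identity. *)
have bE : b = 2 / z by apply: (mulfI zn0); rewrite zb mulrC divfK.
have rE : 1 + r2 = 4 / z - 1.
  have -> : 4 / z = 2 * b.
    by rewrite bE; move: z zn0 => Z Z0; field.
  by rewrite /wmax; lra.
move: (E x) en0 (scaled_gap x) X0 (boundary_defect x) (boundary'_defect x) => Ex Ex0 X X0 h1 h2.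
rewrite rE bE; move: z zn0 => Z Z0.
by field; rewrite Ex0 X0 Z0 x0.
Unshelve. all: by end_near. Qed.

End low_temperature_expansion.

(** * Translation to temperature and the four asymptotic statements *)

Section specific_heats.
Context {R : realType}.
Local Notation r2 := (Num.sqrt 2 : R).
Local Notation H := (hamiltonian (- (1 / 2)) (1 / 2 + r2 / 2) (r2 / 2)).
Local Notation Phi := (exp_moment (dV R) (phase_space R) H).
Local Notation V := (@energy_variance R).

Lemma integrable_phase_moment j x : (dV R).-integrable (phase_space R)
  (EFin \o (fun s => H s ^+ j * expR (x * H s))).
Proof.
have [mH [M HM]] := bounded_measurable_hamiltonian (- (1 / 2) : R) (1 / 2 + r2 / 2) (r2 / 2).
apply: (integrable_exp_moment _ (@phase_space_lty R) _ HM).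
- exact: measurable_phase_space.
- exact: measurable_funTS.
Qed.

Lemma mean_energyE beta : U H 1 beta = Phi 1 (- beta) / Phi 0 (- beta).
Proof.
have ZE : Z H beta = Phi 0 (- beta).
  by apply: eq_Rintegral => s _; move: (H s) => h; rewrite expr0 mul1r.
by rewrite /U ZE mulrC.
Qed.

Lemma mean_energyNE beta :
  U (fun s => - H s) 1 beta = - (Phi 1 beta / Phi 0 beta).
Proof.
have ZE : Z (fun s => - H s) beta = Phi 0 beta.
  by apply: eq_Rintegral => s _; move: (H s) => h; rewrite expr0 mul1r mulrNN.
rewrite /U ZE [LHS]mulrC -[RHS]mulNr; congr (_ * _).
transitivity (\int[dV R]_(s in phase_space R) (-1 * (H s ^+ 1 * expR (beta * H s)))).
  by apply: eq_Rintegral => s _; move: (H s) => h; rewrite mulrNN !expr1 mulN1r mulNr.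
rewrite RintegralZl; last 2 first.
- exact: measurable_phase_space.
- exact: integrable_phase_moment.
by rewrite [LHS]mulN1r.
Qed.

Lemma is_derive_inv (x : R) : x != 0 ->
  is_derive (x : R) (1 : R) (fun t => t^-1) (- x ^- 2).
Proof.
move=> x0; have h := is_derive_id x (1 : R).
have hV : is_derive (x : R) (1 : R) (fun t => t^-1) (- x ^- 2 *: 1).
  by exact: is_deriveV.
by apply: (is_derive_eq hV); rewrite /GRing.scale/= mulr1.
Qed.

Lemma specific_heatE T : T != 0 -> specific_heat H T = T^-1 ^+ 2 * V (- T^-1).
Proof.
move=> T0; rewrite /specific_heat.
have [g gE] : exists g : R -> R, g = fun t => - t^-1 by exists (fun t => - t^-1).
rewrite (_ : (fun t => _) = (fun x => Phi 1 x / Phi 0 x) \o g); last first.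
  by apply/funext => t; rewrite mean_energyE gE.
have di : is_derive (T : R) (1 : R) g (T ^- 2).
  by rewrite gE; have h := is_derive_inv T0; apply: is_derive_eq; rewrite opprK.
have h := is_derive1_comp (is_derive_mean_energy (g T)) di.
rewrite derive1E (@derive_val _ _ _ _ _ _ _ h) gE exprVn /GRing.scale/=.
by rewrite [LHS]mulrC.
Qed.

Lemma specific_heatNE T : T != 0 ->
  specific_heat (fun s => - H s) T = T^-1 ^+ 2 * V T^-1.
Proof.
move=> T0; rewrite /specific_heat.
have [g gE] : exists g : R -> R, g = fun t => t^-1 by exists (fun t => t^-1).
rewrite (_ : (fun t => _) = (fun x => - (Phi 1 x / Phi 0 x)) \o g); last first.
  by apply/funext => t; rewrite mean_energyNE gE.
have di : is_derive (T : R) (1 : R) g (- T ^- 2).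
  by rewrite gE; exact: is_derive_inv.
have du : is_derive (g T : R) (1 : R) (fun x => - (Phi 1 x / Phi 0 x)) (- V (g T)).
  by have h := is_derive_mean_energy (g T); exact: is_deriveN.
have h := is_derive1_comp du di.
rewrite derive1E (@derive_val _ _ _ _ _ _ _ h) gE exprVn /GRing.scale/=.
by rewrite [LHS]mulrNN [LHS]mulrC.
Qed.

Lemma energy_variance0 : V 0 = (3 + r2) / 6.
Proof.
have [p0 p1 p2] := @hamiltonian_moments R; rewrite /energy_variance p0 p1 p2.
have : (pi : R) != 0 by rewrite gt_eqF// pi_gt0.
by move: (pi : R) => P P0; field.
Qed.

(** Differentiability at x = 0 turns the value of the variance there into an expansion with
    remainder O(1 / T). *)
Lemma derivable_energy_variance : derivable V 0 1.
Proof.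
have h0 := @is_derive_phase_moment R 0 0; have h1 := @is_derive_phase_moment R 1 0.
have h2 := @is_derive_phase_moment R 2 0.
have hX := is_derive_fX 2 h0.
have n0 : Phi 0 0 ^+ 2 != 0 by rewrite expf_neq0// gt_eqF// phase_partition_gt0.
have hV : is_derive (0 : R) (1 : R) (fun x => (Phi 0 x ^+ 2)^-1)
    (- (Phi 0 0 ^+ 2) ^- 2 *: (2 * Phi 0 0 ^+ 1 * Phi 1 0)).
  by exact: is_deriveV.
by have [] := is_derive_fM (is_deriveB (is_derive_fM h2 h0) (is_derive_fX 2 h1)) hV.
Qed.

Lemma inv_cvg0 : (fun T : R => T^-1) @ +oo --> (0 : R).
Proof. by apply/(@gtr0_cvgV0 _ _ _ _ id) => //; exact: nbhs_pinfty_gt. Qed.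

Lemma inv_cvgy : (fun T : R => T^-1) @ 0^'+ --> +oo.
Proof.
apply/(@cvgrVy _ _ _ _ id); first exact: nbhs_right_gt.
by apply: cvg_within_filter; exact: cvg_id.
Qed.

Lemma near_right0_inv (P : R -> Prop) : (\forall x \near +oo, P x) ->
  \forall T \near 0^'+, P T^-1.
Proof. by move=> h; exact: (inv_cvgy h). Qed.

(** The sign is -1 for H and 1 for -H. Both arguments tend to 0, so the leading terms agree. *)
Lemma high_temperature (sg : R) : `|sg| = 1 -> exists C, \forall T \near +oo,
  `|T^-1 ^+ 2 * V (sg * T^-1) - (3 + r2) / (6 * T ^+ 2)| <= C * `|T ^- 3|.
Proof.
move=> sg1; have [C hC] := derivable_near0_le derivable_energy_variance.
have sg0 : (fun T : R => sg * T^-1) @ +oo --> (0 : R).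
  by rewrite -[X in _ --> X](mulr0 sg); apply: cvgM; [exact: cvg_cst|exact: inv_cvg0].
exists C; have hT := sg0 _ hC; near=> T.
have T0 : T != 0 by rewrite gt_eqF//; near: T; exact: nbhs_pinfty_gt.
have h : `|V (sg * T^-1) - V 0| <= C * `|sg * T^-1| by near: T.
rewrite (_ : _ - _ = T^-1 ^+ 2 * (V (sg * T^-1) - V 0)); last first.
  by rewrite energy_variance0; field.
rewrite normrM (_ : `|T ^- 3| = `|T^-1 ^+ 2| * `|T^-1|); last first.
  by rewrite -normrM -exprSr exprVn.
rewrite mulrCA ler_wpM2l//.
by move: h; rewrite normrM sg1 mul1r.
Unshelve. all: by end_near. Qed.

Lemma specific_heat_pinfty : exists C, \forall T \near +oo,
  `|specific_heat H T - (3 + r2) / (6 * T ^+ 2)| <= C * `|T ^- 3|.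
Proof.
have [|C hC] := @high_temperature (-1); first by rewrite normrN1.
exists C; apply: filterS2 hC (nbhs_pinfty_gt (num_real 0)) => T hT T0.
rewrite mulN1r in hT; rewrite specific_heatE; first exact: hT.
by rewrite gt_eqF.
Qed.

Lemma specific_heatN_pinfty : exists C, \forall T \near +oo,
  `|specific_heat (fun s => - H s) T - (3 + r2) / (6 * T ^+ 2)| <= C * `|T ^- 3|.
Proof.
have [|C hC] := @high_temperature 1; first by rewrite normr1.
exists C; apply: filterS2 hC (nbhs_pinfty_gt (num_real 0)) => T hT T0.
rewrite mul1r in hT; rewrite specific_heatNE; first exact: hT.
by rewrite gt_eqF.
Qed.

Lemma specific_heat_right0 : exists C, \forall T \near 0^'+,
  `|specific_heat H T - (2 + 4 / 9 * (2 - r2) * T + 40 / 27 * (3 - 2 * r2) * T ^+ 2)|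
    <= C * `|T ^+ 3|.
Proof.
have [C hC] := @sqr_energy_variance_ninfty R.
exists C; apply: filterS2 (near_right0_inv hC) (nbhs_right_gt 0) => T /= hT T0.
rewrite specific_heatE; last by rewrite gt_eqF.
rewrite (ger0_norm (exprn_ge0 3 (ltW T0))).
have h := @sqr_sqrt2 R.
(* With x = 1 / T the variable v is 2 kappa T / 9, and (2 - r2)^2 = 2 (3 - 2 r2) turns 15 v^2 into
   the stated quadratic term. *)
rewrite (_ : 2 + _ + _ = 2 + 2 * (2 * @kappa R / 9 * T^-1^-1)
   + 15 * (2 * @kappa R / 9 * T^-1^-1) ^+ 2); last first.
  rewrite invrK /kappa; apply/eqP; rewrite -subr_eq0; apply/eqP.
  transitivity ((2 - r2 * r2) * (20 / 27 * T ^+ 2)); last by rewrite h subrr mul0r.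
  by field.
by rewrite -[T ^+ 3]invrK -[(T ^+ 3)^-1]exprVn; exact: hT.
Qed.

Lemma specific_heatN_right0 :
  specific_heat (fun s => - H s) T @[T --> 0^'+] --> (3 / 2 : R).
Proof.
apply/cvgrPdist_le => e e0.
have h := decays1_small e0 (@sqr_energy_variance_pinfty R).
apply: filterS2 (near_right0_inv h) (nbhs_right_gt 0) => T /= hT T0.
rewrite distrC specific_heatNE; first exact: hT.
by rewrite gt_eqF.
Qed.

End specific_heats.

Lemma bigO_intro (R : realType) (F : filter_on R) (f g e : R -> R) (C : R) :
  (\forall x \near F, `|f x - g x| <= C * `|e x|) -> f = g +O_F e.
Proof.
move=> h; apply/eqaddOP; exists C; split; first exact: num_real.
move=> l Cl; apply: filterS h => x hx; apply: (le_trans hx).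
by rewrite ler_wpM2r// ltW.
Qed.

Unset Implicit Arguments.

Theorem mainTheorem3 (R : realType) :
  let J1 : R := - (1 / 2) in
  let J2 : R := 1 / 2 + Num.sqrt 2 / 2 in
  let J3 : R := Num.sqrt 2 / 2 in
  let H := hamiltonian J1 J2 J3 in
  let c : R -> R := specific_heat H in
  let cstar : R -> R := specific_heat (fun s => - H s) in
  [/\ c = (fun T : R => (3 + Num.sqrt 2) / (6 * T ^+ 2))
            +O_ (pinfty_nbhs R) (fun T : R => T ^- 3),
      cstar = (fun T : R => (3 + Num.sqrt 2) / (6 * T ^+ 2))
            +O_ (pinfty_nbhs R) (fun T : R => T ^- 3),
      c = (fun T : R => 2 + 4 / 9 * (2 - Num.sqrt 2) * T
                          + 40 / 27 * (3 - 2 * Num.sqrt 2) * T ^+ 2)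
            +O_ (0^'+) (fun T : R => T ^+ 3)
    & cstar T @[T --> 0^'+] --> (3 / 2 : R)].
Proof.
move=> J1 J2 J3 H c cstar; split.
- have [C hC] := @specific_heat_pinfty R.
  by apply: (@bigO_intro _ _ _ _ _ C); exact: hC.
- have [C hC] := @specific_heatN_pinfty R.
  by apply: (@bigO_intro _ _ _ _ _ C); exact: hC.
- have [C hC] := @specific_heat_right0 R.
  by apply: (@bigO_intro _ _ _ _ _ C); exact: hC.
- exact: specific_heatN_right0.
Qed.
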